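(* Let $d\ge 2$ and $n_1,\dots,n_d\ge 1$ be integers, and let $\mathcal A\in\mathbb R^{n_1\times\cdots\times n_d}$ be a random tensor whose entries are independent standard normal random variables. Then $$\mathbb E\,\rho(\mathcal A)\le \sqrt{n_1}+\cdots+\sqrt{n_d},$$ and $$\mathbb E\,\rho_{\ell^d}(\mathcal A)\le 2^{\frac d2}\left(\pi^{-\frac12}\,\Gamma\left(\frac{1}{2(d-1)}+1\right)\right)^{\frac{d-1}{d}}\prod_{j=1}^d n_j^{\frac{d-2}{2d}}\sum_{j=1}^d n_j^{\frac12}\le 2^{\frac{d-1}{2}}\prod_{j=1}^d n_j^{\frac{d-2}{2d}}\sum_{j=1}^d n_j^{\frac12},$$ where $\Gamma(\cdot)$ is the Gamma function.
   Context: For $\mathcal A\in\mathbb R^{n_1\times\cdots\times n_d}$ and vectors $\mathbf u_j\in\mathbb R^{n_j}$, write $\langle\mathcal A,\bigotimes_{j=1}^d\mathbf u_j\rangle=\sum_{i_1=1}^{n_1}\cdots\sum_{i_d=1}^{n_d}\mathcal A_{i_1\cdots i_d}\,\mathbf u_{1,i_1}\cdots\mathbf u_{d,i_d}$, where $\mathbf u_{j,i}$ is the $i$-th entry of $\mathbf u_j$. Let $\|\cdot\|$ be the Euclidean norm and $\|\cdot\|_d$ the $\ell^d$-norm, $\|\mathbf u\|_d=(\sum_i|\mathbf u_i|^d)^{1/d}$. The largest ($\ell^2$-) singular value of $\mathcal A$ is $$\rho(\mathcal A)=\max\left\{\left\langle\mathcal A,\bigotimes_{j=1}^d\mathbf u_j\right\rangle:\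 \mathbf u_j\in\mathbb R^{n_j},\ \|\mathbf u_j\|=1,\ j=1,\dots,d\right\},$$ and the largest $\ell^d$-singular value of $\mathcal A$ (with $d$ equal to the order of the tensor) is $$\rho_{\ell^d}(\mathcal A)=\max\left\{\left\langle\mathcal A,\bigotimes_{j=1}^d\mathbf u_j\right\rangle:\ \mathbf u_j\in\mathbb R^{n_j},\ \|\mathbf u_j\|_d=1,\ j=1,\dots,d\right\}.$$ *)

(* Defs.v *)
From HB Require Import structures.
From mathcomp Require Export all_boot all_order all_algebra.
From mathcomp Require Export all_classical all_reals all_analysis.

Set Implicit Arguments.
Unset Strict Implicit.
Unset Printing Implicit Defensive.

Import Order.TTheory GRing.Theory Num.Theory.
Import numFieldNormedType.Exports.

Local Open Scope classical_set_scope.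
Local Open Scope ring_scope.

Definition multi_index (d : nat) (n : 'I_d -> nat) : finType :=
  {dffun forall j : 'I_d, 'I_(n j)}.

Definition tensor (R : realType) (d : nat) (n : 'I_d -> nat) : Type :=
  multi_index n -> R.

Definition vectors (R : realType) (d : nat) (n : 'I_d -> nat) : Type :=
  forall j : 'I_d, 'rV[R]_(n j).

Definition tensor_inner (R : realType) (d : nat) (n : 'I_d -> nat)
    (A : tensor R n) (u : vectors R n) : R :=
  \sum_(i : multi_index n) A i * \prod_(j < d) u j 0 (i j).

Definition euclidean_norm (R : realType) (m : nat) (u : 'rV[R]_m) : R :=
  Num.sqrt (\sum_(i < m) u 0 i ^+ 2).

Definition lp_norm (R : realType) (p m : nat) (u : 'rV[R]_m) : R :=
  (\sum_(i < m) `|u 0 i| ^+ p) `^ p%:R^-1.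

(* The suprema below are maxima: see [singular_value_max] and
   [lp_singular_value_max]. *)
Definition singular_value (R : realType) (d : nat) (n : 'I_d -> nat)
    (A : tensor R n) : R :=
  sup [set tensor_inner A u | u in
        [set u : vectors R n | forall j, euclidean_norm (u j) = 1]].

Definition lp_singular_value (R : realType) (d : nat) (n : 'I_d -> nat)
    (A : tensor R n) : R :=
  sup [set tensor_inner A u | u in
        [set u : vectors R n | forall j, lp_norm d (u j) = 1]].

Lemma sup_image_max (R : realType) (T : Type) (f : T -> R) (D : set T) (u : T) :
  D u -> (forall v, D v -> f v <= f u) -> f u = sup [set f v | v in D].
Proof.
move=> Du umax; apply/eqP; rewrite eq_le; apply/andP; split.
  by apply: ub_le_sup; [exists (f u) => _ [v Dv <-]; exact: umax | exists u].
by apply: ge_sup; [exists (f u); exists u | move=> _ [v Dv <-]; exact: umax].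
Qed.

Lemma lp_norm_eq1 (R : realType) (p m : nat) (u : 'rV[R]_m) : (0 < p)%N ->
  lp_norm p u = 1 <-> \sum_(i < m) `|u 0 i| ^+ p = 1.
Proof.
move=> p0; rewrite /lp_norm; split => [|->]; last by rewrite powR1.
have s0 : 0 <= \sum_(i < m) `|u 0 i| ^+ p.
  by apply: sumr_ge0 => i _; rewrite exprn_ge0.
move=> /(congr1 (fun x => x `^ p%:R)).
by rewrite -powRrM mulVf ?pnatr_eq0 -?lt0n// powRr1// powR1.
Qed.

Lemma euclidean_norm_eq1 (R : realType) (m : nat) (u : 'rV[R]_m) :
  euclidean_norm u = 1 <-> \sum_(i < m) `|u 0 i| ^+ 2 = 1.
Proof.
rewrite /euclidean_norm.
have -> : \sum_(i < m) `|u 0 i| ^+ 2 = \sum_(i < m) u 0 i ^+ 2.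
  by apply: eq_bigr => i _; rewrite real_normK// num_real.
have s0 : 0 <= \sum_(i < m) u 0 i ^+ 2 by apply: sumr_ge0 => i _; rewrite sqr_ge0.
split => [|->]; last by rewrite sqrtr1.
by move=> /(congr1 (fun x => x ^+ 2)); rewrite sqr_sqrtr// expr1n.
Qed.

Lemma sphere_compact (R : realType) (p m : nat) : (0 < p)%N ->
  compact [set u : 'rV[R]_m | \sum_(i < m) `|u 0 i| ^+ p = 1].
Proof.
move=> p0; set S := (X in compact X).
have cube : compact [set u : 'rV[R]_m | forall i, [set` `[-1, 1]] (u ord0 i)].
  by apply: (@rV_compact R m (fun=> [set` `[-1, 1]])) => i; exact: segment_compact.
apply: (subclosed_compact _ cube).
- have -> : S = (fun u : 'rV[R]_m => \sum_(i < m) `|u 0 i| ^+ p) @^-1` [set 1].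
    by [].
  apply: preimage_closed => [x _|]; last exact: closed_eq.
  move: x.
  apply: (@continuous_big R 'I_m +%R 0 xpredT _ 'rV[R]_m _
    (fun i u => `|u 0 i| ^+ p)) => [|i _ x]; first exact: add_continuous.
  apply: (@continuous_comp _ _ _ (fun u : 'rV[R]_m => `|u 0 i|) (fun y => y ^+ p)).
    apply: (@continuous_comp _ _ _ (fun u : 'rV[R]_m => u 0 i) Num.norm).
      exact: coord_continuous.
    exact: norm_continuous.
  exact: exprn_continuous.
- move=> u /= Su i; rewrite in_itv/= -ler_norml leNgt; apply/negP => u1.
  suff : 1 < \sum_(i < m) `|u 0 i| ^+ p by rewrite Su ltxx.
  rewrite (bigD1 i)//= ltr_wpDr//; last by rewrite exprn_egt1// -lt0n.
  by apply: sumr_ge0 => j _; rewrite exprn_ge0.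
Qed.

Lemma tensor_inner_attains_max (R : realType) (d : nat) (n : 'I_d -> nat)
    (p : nat) (A : tensor R n) : (0 < p)%N -> (forall j, (0 < n j)%N) ->
  exists2 u : vectors R n, (forall j, \sum_(i < n j) `|u j 0 i| ^+ p = 1) &
    forall v : vectors R n, (forall j, \sum_(i < n j) `|v j 0 i| ^+ p = 1) ->
      tensor_inner A v <= tensor_inner A u.
Proof.
move=> p0 n0.
set S := [set u : prod_topology (fun j => 'rV[R]_(n j)) |
  forall j, \sum_(i < n j) `|u j 0 i| ^+ p = 1].
have cS : compact S.
  apply: (@tychonoff 'I_d (fun j => 'rV[R]_(n j)) (fun j =>
    [set u : 'rV[R]_(n j) | \sum_(i < n j) `|u 0 i| ^+ p = 1])) => j.
  exact: sphere_compact.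
have S0 : S !=set0.
  exists (fun j => delta_mx 0 (Ordinal (n0 j))) => j.
  rewrite (bigD1 (Ordinal (n0 j)))//= mxE !eqxx normr1 expr1n big1 ?addr0//.
  by move=> i /negPf ij; rewrite mxE eqxx ij normr0 expr0n gtn_eqF.
pose f (u : prod_topology (fun j => 'rV[R]_(n j))) : R := tensor_inner A u.
have cf : continuous f.
  pose T := prod_topology (fun j => 'rV[R]_(n j)).
  apply: (@continuous_big R (multi_index n) +%R 0 xpredT _ T _
    (fun i u => A i * \prod_(j < d) u j 0 (i j))) => [|i _ x].
    exact: add_continuous.
  apply: continuousM; first exact: cst_continuous.
  apply: (@continuous_big R 'I_d *%R 1 xpredT _ T _
    (fun j u => u j 0 (i j))) => [|j _ {}x]; first exact: mul_continuous.
  move: x; have cc : continuous (fun v : 'rV[R]_(n j) => v 0 (i j)).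
    exact: coord_continuous.
  have cp : continuous (fun u : T => u j : 'rV[R]_(n j)).
    exact: (@proj_continuous _ (fun j => 'rV[R]_(n j)) j).
  move=> x; exact: (continuous_comp (cp x) (cc _)).
have [u uS umax] := compact_EVT_max S0 cS (continuous_subspaceT cf).
exists u; first exact: set_mem uS.
by move=> v vS; apply: (umax v); exact/mem_set.
Qed.

Lemma singular_value_max (R : realType) (d : nat) (n : 'I_d -> nat)
    (A : tensor R n) : (forall j, (0 < n j)%N) ->
  exists2 u : vectors R n, (forall j, euclidean_norm (u j) = 1) &
    tensor_inner A u = singular_value A /\
    forall v : vectors R n, (forall j, euclidean_norm (v j) = 1) ->
      tensor_inner A v <= tensor_inner A u.
Proof.
move=> /(@tensor_inner_attains_max R d n 2 A isT)[u u1 umax].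
have u1' j : euclidean_norm (u j) = 1 by exact/euclidean_norm_eq1.
have umax' v : (forall j, euclidean_norm (v j) = 1) ->
  tensor_inner A v <= tensor_inner A u.
  by move=> v1; apply: umax => j; exact/euclidean_norm_eq1.
exists u => //; split=> //; exact: sup_image_max.
Qed.

Lemma lp_singular_value_max (R : realType) (d : nat) (n : 'I_d -> nat)
    (A : tensor R n) : (0 < d)%N -> (forall j, (0 < n j)%N) ->
  exists2 u : vectors R n, (forall j, lp_norm d (u j) = 1) &
    tensor_inner A u = lp_singular_value A /\
    forall v : vectors R n, (forall j, lp_norm d (v j) = 1) ->
      tensor_inner A v <= tensor_inner A u.
Proof.
move=> d0 /(@tensor_inner_attains_max R d n d A d0)[u u1 umax].
have u1' j : lp_norm d (u j) = 1 by exact/lp_norm_eq1.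
have umax' v : (forall j, lp_norm d (v j) = 1) ->
  tensor_inner A v <= tensor_inner A u.
  by move=> v1; apply: umax => j; exact/lp_norm_eq1.
exists u => //; split=> //; exact: sup_image_max.
Qed.

Definition mutually_independent (R : realType) (disp : measure_display)
    (Omega : measurableType disp) (P : probability Omega R) (I : finType)
    (X : I -> {RV P >-> R}) : Prop :=
  forall (J : {set I}) (B : I -> set R), (forall i, measurable (B i)) ->
    P (\bigcap_(i in [set` J]) (X i @^-1` B i)) =
    (\prod_(i in J) P (X i @^-1` B i))%E.

Definition standard_normal (R : realType) (disp : measure_display)
    (Omega : measurableType disp) (P : probability Omega R)
    (X : {RV P >-> R}) : Prop :=
  forall B : set R, measurable B -> distribution P X B = normal_prob 0 1 B.

Definition Gamma (R : realType) (x : R) : R :=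
  \int[lebesgue_measure]_(t in `]0, +oo[) (t `^ (x - 1) * expR (- t)).

(* Main.v *)
Require Import Defs.
From HB Require Import structures.
From mathcomp Require Import ring lra.
From mathcomp Require Import measurable_realfun.
Set Implicit Arguments.
Unset Strict Implicit.
Unset Printing Implicit Defensive.
Import Order.TTheory GRing.Theory Num.Theory.
Import numFieldNormedType.Exports.
Local Open Scope classical_set_scope.
Local Open Scope ring_scope.

(** The two suprema are compared, by Sudakov-Fernique, with the supremum of
    [\sum_j lam_j <g_j, u_j>] for independent standard Gaussian vectors [g_j]:
    the increments of [u |-> <A, u_1 (x) ... (x) u_d>] are at most
    [\sum_j lam_j^2 |u_j - v_j|^2], with [lam_j = 1] on the Euclidean spheres and
    [lam_j = sqrt d * \prod_(k != j) n_k^((d-2)/(2d))] on the l^d spheres; the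
    factor [sqrt d <= 2^((d-1)/2)] comes from Cauchy-Schwarz.  Young's inequality
    with a deterministic scale [r_j] then replaces both Hoelder's and Jensen's
    inequalities in the bound of [E sup_u <g_j, u>] by an absolute moment, which
    is a value of Gamma.

    To avoid Gaussian measures in several dimensions, the standard normal law is
    rounded to a finitely supported one.  Expectations over independent copies
    become finite sums, along which the smoothed maximum
    [b^-1 * ln (\sum_t exp (b z_t))] of [cos th * X + sin th * Y] can be
    differentiated in [th] without further ado; Gaussian integration by parts
    survives the rounding up to an error that vanishes with the mesh.  The finite
    index set needed by the smoothed maximum consists of the maximisers of the
    (finitely many) tensors with coarsely rounded entries. *)


(** * The standard normal law *)

Section standard_normal_integral.
Context {R : realType}.
Local Notation mu := (@lebesgue_measure R).
Local Notation gamma := (@normal_prob R 0 1).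
Local Notation phi := (@normal_pdf R 0 1).

Let mphi : measurable_fun setT (EFin \o phi : measurableTypeR R -> _).
Proof. by apply/measurable_EFinP; exact: measurable_normal_pdf. Qed.

Import HBNNSimple.

Let nnsfun_integral (f : {nnsfun (measurableTypeR R) >-> R}) :
  (\int[gamma]_x (f x)%:E = \int[mu]_x ((f x)%:E * (phi x)%:E))%E.
Proof.
under [LHS]eq_integral do rewrite fimfunE -fsumEFin//.
rewrite [LHS]ge0_integral_fsum//; last 2 first.
  - by move=> r; exact/measurable_EFinP/measurableT_comp.
  - by move=> n x _; rewrite EFinM nnfun_muleindic_ge0.
under [RHS]eq_integral.
  move=> x xD; rewrite fimfunE -fsumEFin// ge0_mule_fsuml; last first.
    by move=> r; rewrite EFinM nnfun_muleindic_ge0.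
  over.
rewrite [RHS]ge0_integral_fsum//; last 2 first.
  - move=> r; apply: emeasurable_funM => //.
    by apply/measurable_EFinP; do 2 apply/measurableT_comp => //.
  - move=> n x _; rewrite EFinM mule_ge0//; first by rewrite nnfun_muleindic_ge0.
    by rewrite lee_fin normal_pdf_ge0.
apply: eq_fsbigr => r _.
rewrite integralZl_indic_nnsfun//= integral_indic//= setIT /normal_prob.
have [r0|r0] := ltP r 0.
  have -> : f @^-1` [set r] = set0.
    apply/seteqP; split => // x /= xr; have : 0 <= f x by [].
    by rewrite [f x]xr leNgt r0.
  rewrite integral_set0 mule0; apply/esym/integral0_eq => x _.
  by rewrite indicE in_set0 mulr0 mul0e.
under [RHS]eq_integral do rewrite EFinM -muleA.
rewrite ge0_integralZl//; last 2 first.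
  - apply: emeasurable_funM => //.
    exact/measurable_EFinP/measurable_indic.
  - by move=> x _; rewrite mule_ge0// lee_fin ?normal_pdf_ge0.
congr (_ * _)%E; rewrite [LHS]integral_mkcond/=.
apply: eq_integral => x _; rewrite patchE indicE.
by case: ifPn => _; rewrite ?mul1e ?mul0e.
Qed.

Lemma ge0_integral_normal_prob (f : measurableTypeR R -> \bar R) :
  measurable_fun setT f -> (forall x, 0 <= f x)%E ->
  (\int[gamma]_x f x = \int[mu]_x (f x * (phi x)%:E))%E.
Proof.
move=> mf f0.
pose f_ := nnsfun_approx measurableT mf.
transitivity (lim (\int[gamma]_x (f_ n x)%:E @[n --> \oo])%E).
  rewrite -monotone_convergence//=.
  - apply: eq_integral => ? /[!inE] xD; apply/esym/cvg_lim => //=.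
    exact: cvg_nnsfun_approx.
  - by move=> k; apply/measurable_EFinP; exact: measurable_funTS.
  - by move=> n ? _; rewrite lee_fin.
  - by move=> ? _ ? ? mn; rewrite lee_fin; exact/lefP/nd_nnsfun_approx.
rewrite [RHS](_ : _ = lim (\int[mu]_x ((f_ n x)%:E * (phi x)%:E) @[n --> \oo])%E).
  by apply: congr_lim; apply/funext => k /=; exact: nnsfun_integral.
rewrite -monotone_convergence//=.
- apply: eq_integral => x /[!inE] xD; apply/esym/cvg_lim => //=.
  apply: cvgeMr => //; exact: cvg_nnsfun_approx.
- move=> k; apply: emeasurable_funM => //.
  by apply/measurable_EFinP; exact: measurable_funTS.
- by move=> k x _; rewrite mule_ge0// lee_fin// normal_pdf_ge0.
- move=> x _ a b ab; rewrite lee_wpmul2r ?lee_fin ?normal_pdf_ge0//.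
  exact/lefP/nd_nnsfun_approx.
Qed.

Lemma integral_normal_prob (f : measurableTypeR R -> R) : measurable_fun setT f ->
  (\int[gamma]_x (f x)%:E = \int[mu]_x (f x * phi x)%:E)%E.
Proof.
move=> mf; have mfE : measurable_fun setT (EFin \o f) by exact/measurable_EFinP.
rewrite integralE [RHS]integralE.
rewrite !ge0_integral_normal_prob//; last 2 first.
- exact: measurable_funeneg.
- exact: measurable_funepos.
congr (_ - _)%E; apply: eq_integral => x _.
  rewrite !funeposE -!EFin_max -EFinM; congr EFin.
  by rewrite maxr_pMl ?normal_pdf_ge0// mul0r.
rewrite !funenegE -!EFinN -!EFin_max -EFinM; congr EFin.
by rewrite maxr_pMl ?normal_pdf_ge0// mul0r mulNr.
Qed.

Lemma integrable_normal_prob (f : measurableTypeR R -> R) : measurable_fun setT f ->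
  gamma.-integrable setT (EFin \o f) ->
  mu.-integrable setT (fun x => (f x * phi x)%:E).
Proof.
move=> mf /integrableP[_ fi]; apply/integrableP; split.
  by apply/measurable_EFinP/measurable_funM => //; exact: measurable_normal_pdf.
rewrite (le_lt_trans _ fi)// ge0_integral_normal_prob//; last first.
  by apply/measurableT_comp => //; exact/measurable_EFinP.
apply: ge0_le_integral => //.
- apply/measurableT_comp => //; apply/measurable_EFinP/measurable_funM => //.
  exact: measurable_normal_pdf.
- apply: emeasurable_funM => //; apply/measurableT_comp => //.
  exact/measurable_EFinP.
- by move=> x _; rewrite /= normrM (ger0_norm (normal_pdf_ge0 _ _ _)).
Qed.

End standard_normal_integral.

(** * Derivative and decay of the Gaussian density, and integrals of derivatives over the line *)

Section gaussian_calculus.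
Context {R : realType}.
Local Notation mu := (@lebesgue_measure R).
Local Notation gamma := (@normal_prob R 0 1).
Local Notation phi := (@normal_pdf R 0 1).

Lemma std_normal_pdfE (x : R) : phi x = normal_peak 1 * expR (- x ^+ 2 / 2).
Proof. by rewrite normal_pdfE ?oner_eq0// /normal_fun subr0 expr1n. Qed.

Lemma is_derive_std_normal_pdf (x : R) : is_derive x 1 phi (- x * phi x).
Proof.
have -> : phi = (fun x : R => normal_peak 1 * expR (- x ^+ 2 / 2)).
  by apply/funext => y; rewrite std_normal_pdfE.
apply: is_derive_eq.
rewrite /GRing.scale/= !mulr1 !mulr0 !add0r ?mulr_natr.
set e := expR _; lra.
Qed.

(** Splitting [x ^+ 2 / 2] as [3 / 8 * x ^+ 2 + x ^+ 2 / 8] leaves the density of standard deviation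
    2 times a factor that beats any polynomial. This gives an integrable majorant for everything of
    quartic growth. *)
Lemma std_normal_pdf_decay : exists2 C : R, 0 < C &
  forall x : R, (1 + x ^+ 4) * phi x <= C * normal_pdf 0 2 x.
Proof.
have p1 : 0 < normal_peak (1 : R) by apply: normal_peak_gt0; rewrite oner_eq0.
have p2 : 0 < normal_peak (2 : R) by apply: normal_peak_gt0; rewrite pnatr_eq0.
(* [29] exceeds [256 / 9], the square of [16 / 3], so [1 + x ^+ 4 <= 29 * (1 + 3 / 16 * x ^+ 2) ^+
   2], and that square is at most [expR (3 / 8 * x ^+ 2)]. *)
exists (29 * normal_peak 1 / normal_peak 2); first by rewrite !mulr_gt0// invr_gt0.
move=> x; rewrite std_normal_pdfE (normal_pdfE 0 (_ : 2 != 0)) ?pnatr_eq0//.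
rewrite /normal_fun subr0 -(mulrA (29 * _)) mulKf ?gt_eqF//.
rewrite mulrCA -(mulrA 29) (mulrCA 29) ler_pM2l//.
have -> : - x ^+ 2 / 2 = - (3 / 8 * x ^+ 2) + - x ^+ 2 / (2 ^+ 2 *+ 2) :> R by lra.
rewrite expRD mulrA ler_pM2r ?expR_gt0// expRN ler_pdivrMr ?expR_gt0//.
have -> : expR (3 / 8 * x ^+ 2) = expR (3 / 16 * x ^+ 2) ^+ 2.
  by rewrite -expRM_natl; congr expR; lra.
have h : 1 + 3 / 16 * x ^+ 2 <= expR (3 / 16 * x ^+ 2) by exact: expR_ge1Dx.
have x2 : 0 <= x ^+ 2 by exact: sqr_ge0.
have -> : x ^+ 4 = (x ^+ 2) ^+ 2 by rewrite -exprM.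
nra.
Qed.

Lemma std_normal_integrable (f : measurableTypeR R -> R) (C : R) :
  measurable_fun setT f ->
  (forall y, `|f y| <= C * (1 + y ^+ 4)) ->
  gamma.-integrable setT (EFin \o f).
Proof.
move=> mf fC; have [K K0 hK] := std_normal_pdf_decay.
have C0 : 0 <= C.
  have := fC 0; rewrite expr0n addr0 mulr1; exact: le_trans.
have mabs : measurable_fun setT (fun x => `|(f x)%:E|%E).
  by apply: measurableT_comp => //; exact/measurable_EFinP.
apply/integrableP; split; first exact/measurable_EFinP.
rewrite ge0_integral_normal_prob//.
apply: (@le_lt_trans _ _ (\int[mu]_x ((C * K)%:E * (normal_pdf 0 2 x)%:E))%E).
  apply: ge0_le_integral => //=.
  - by move=> x _; rewrite lee_fin mulr_ge0// normal_pdf_ge0.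
  - apply: emeasurable_funM => //; apply/measurable_EFinP.
    exact: measurable_normal_pdf.
  - apply: measurable_funeM; apply/measurable_EFinP.
    exact: measurable_normal_pdf.
  move=> x _; rewrite lee_fin.
  apply: (@le_trans _ _ (C * ((1 + x ^+ 4) * phi x))).
    by rewrite mulrA ler_wpM2r ?normal_pdf_ge0.
  by rewrite -mulrA ler_wpM2l.
rewrite integralZl//; last exact: integrable_normal_pdf.
by rewrite integral_normal_pdf mule1 ltry.
Qed.

(** On [[- n.+1, n.+1]] the fundamental theorem of calculus gives a difference of two boundary
    values, which the decay of [H] sends to 0; dominated convergence with majorant [|h|] recovers
    the full integral. *)
Lemma integral_derive_eq0 (H h : R -> R) (K : R) :
  (forall x : R, is_derive x (1 : R) H (h x)) -> continuous h ->
  mu.-integrable setT (EFin \o h) ->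
  (forall x, `|H x| <= K / (1 + `|x|)) ->
  (\int[mu]_x (h x)%:E = 0)%E.
Proof.
move=> dH ch ih HK.
pose f n x := (h x * \1_(`[- n.+1%:R, n.+1%:R]%classic : set R) x)%:E.
have mh : measurable_fun setT (h : measurableTypeR R -> R).
  exact: continuous_measurable_fun.
have fE n : (\int[mu]_x f n x = (H n.+1%:R - H (- n.+1%:R))%:E)%E.
  rewrite EFinB -(@continuous_FTC2 _ h).
  - rewrite [RHS]integral_mkcond/=; apply: eq_integral => x _.
    by rewrite /f patchE indicE; case: ifP; rewrite ?mulr1 ?mulr0.
  - by rewrite gtrN.
  - exact: continuous_subspaceT.
  - have cH : continuous H.
      by move=> x; apply/differentiable_continuous/derivable1_diffP.
    split; first by move=> x _.
    + exact/cvg_at_right_filter/cH.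
    + exact/cvg_at_left_filter/cH.
  - by move=> x _; rewrite derive1E derive_val.
have c1 : (\int[mu]_x f n x @[n --> \oo] --> \int[mu]_x (h x)%:E)%E.
  apply: (@dominated_cvg _ _ _ mu setT measurableT f (EFin \o h) (fun x => `|(h x)%:E|%E)) => //.
  - move=> n; apply/measurable_EFinP/measurable_funM => //.
  - move=> x _; apply: cvg_near_cst; exists `|Num.ceil `|x| |%N => // n /= xn.
    rewrite /f indicE mem_set ?mulr1//= in_itv/= -ler_norml.
    rewrite (le_trans (ceil_ge _))// -(@gez0_abs (Num.ceil `|x|)).
      by rewrite -pmulrn ler_nat (leq_trans xn).
    by rewrite ceil_ge0// (@lt_le_trans _ _ 0).
  - by apply: integrable_abse.
  - move=> n x _; rewrite /f lee_fin normrM indicE.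
    by case: (_ \in _); rewrite ?normr1 ?mulr1// normr0 mulr0.
have c2 : (\int[mu]_x f n x @[n --> \oo] --> 0)%E.
  rewrite (eq_cvg _ _ fE); apply: cvg_EFin; first by near=> n.
  apply/cvgr0Pnorm_le => e e0; near=> n.
  rewrite (le_trans (ler_normB _ _))//.
  rewrite (le_trans (lerD (HK _) (HK _)))// normrN ger0_norm//.
  have K0 : 0 <= K.
    by have := HK 0; rewrite normr0 addr0 divr1; exact: le_trans.
  rewrite -mulrDl ler_pdivrMr ?ltr_pwDl//.
  rewrite -ler_pdivrMl//.
  rewrite (@le_trans _ _ n%:R)//.
    by near: n; exact: nbhs_infty_ger.
  by rewrite -natr1; lra.
exact: (cvg_unique _ c1 c2).
Unshelve. all: by end_near. Qed.

End gaussian_calculus.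

(** * Stein's identity and absolute moments of the normal law *)

Section gaussian_moments.
Context {R : realType}.
Local Notation mu := (@lebesgue_measure R).
Local Notation gamma := (@normal_prob R 0 1).
Local Notation phi := (@normal_pdf R 0 1).

(** Young's inequality for the product of [powR x a] and [1], with conjugate exponents [a^-1] and
    [(1 - a)^-1]. It plays the part of Jensen's inequality for the moments and of the power-mean
    inequality on l^d spheres. *)
Lemma powR_le_tangent (a x : R) : 0 <= a <= 1 -> 0 <= x ->
  x `^ a <= 1 + a * (x - 1).
Proof.
move=> /andP[]; rewrite le_eqVlt => /predU1P[<- _ _|a0].
  by rewrite powRr0 mul0r addr0.
rewrite le_eqVlt => /predU1P[->|a1] x0; first by rewrite powRr1// mul1r subrKC.
have b0 : 0 < 1 - a by rewrite subr_gt0.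
have := @conjugate_powR R (x `^ a) 1 a^-1 (1 - a)^-1 (powR_ge0 _ _) ler01.
rewrite !invr_gt0 a0 b0 !invrK subrKC => /(_ isT isT erefl).
rewrite mulr1 -powRrM divff ?gt_eqF// powRr1// powR1 mul1r.
by move=> /le_trans; apply; lra.
Qed.

(** As [phi' = - x * phi], the function [(h' - x * h) * phi] is the derivative of [h * phi], so its
    integral vanishes. *)
Lemma std_normal_stein (h h' : R -> R) (B : R) :
  (forall x : R, is_derive x (1 : R) h (h' x)) -> continuous h' ->
  (forall x, `|h x| <= B * (1 + `|x|)) -> (forall x, `|h' x| <= B) ->
  \int[gamma]_x (x * h x) = \int[gamma]_x h' x.
Proof.
move=> dh ch' hB h'B.
have B0 : 0 <= B by exact: le_trans (h'B 0).
have ch : continuous h.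
  by move=> x; apply/differentiable_continuous/derivable1_diffP.
have y2 (y : R) : (1 + `|y|) ^+ 2 <= 4 * (1 + y ^+ 4).
  have -> : y ^+ 4 = (`|y| ^+ 2) ^+ 2 by rewrite real_normK ?num_real// -exprM.
  have := normr_ge0 y; have := sqr_ge0 (`|y| - 1); have := sqr_ge0 (`|y| ^+ 2 - 1).
  nra.
have y1 (y : R) : 1 + `|y| <= 4 * (1 + y ^+ 4).
  by rewrite (le_trans _ (y2 y))// expr2 ler_peMl// lerDl.
have mh : measurable_fun setT (h : measurableTypeR R -> R).
  exact: continuous_measurable_fun.
have mh' : measurable_fun setT (h' : measurableTypeR R -> R).
  exact: continuous_measurable_fun.
have mxh : measurable_fun setT ((fun x => x * h x) : measurableTypeR R -> R).
  exact: measurable_funM.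
have ixh : gamma.-integrable setT (EFin \o (fun x => x * h x)).
  apply: (std_normal_integrable (C := 4 * B)) => // y.
  rewrite normrM (le_trans (ler_wpM2l (normr_ge0 _) (hB y)))//.
  rewrite mulrCA -mulrA (mulrCA 4) ler_wpM2l// (le_trans _ (y2 y))//.
  by rewrite expr2 ler_wpM2r ?lerDr// addr_ge0.
have ih' : gamma.-integrable setT (EFin \o h').
  apply: (std_normal_integrable (C := B)) => // y.
  by rewrite (le_trans (h'B y))// ler_peMr// lerDl exprn_even_ge0.
have [K K0 hK] := @std_normal_pdf_decay R.
have : (\int[gamma]_x (h' x - x * h x)%:E = 0)%E.
  rewrite integral_normal_prob; last exact: measurable_funB.
  apply: (@integral_derive_eq0 _ (fun x => h x * phi x) _
      (4 * B * K * normal_peak 2)).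
  - move=> x; have := is_derive_std_normal_pdf x => dphi.
    apply: is_derive_eq; rewrite /GRing.scale/=; ring.
  - have cphi : continuous phi by apply: continuous_normal_pdf; rewrite oner_eq0.
    move=> x; apply: cvgM; last exact: cphi.
    by apply: cvgB; [exact: ch'|apply: cvgM; [exact: cvg_id|exact: ch]].
  - apply: integrable_normal_prob; first exact: measurable_funB.
    exact: (integrableB measurableT ih' ixh).
  - move=> x; have x1 : 0 < 1 + `|x| by rewrite ltr_pwDl.
    rewrite ler_pdivlMr// normrM (ger0_norm (normal_pdf_ge0 _ _ _)).
    rewrite (@le_trans _ _ (4 * B * ((1 + x ^+ 4) * phi x)))//.
      rewrite mulrAC (mulrA _ _ (phi x)) ler_wpM2r ?normal_pdf_ge0//.
      rewrite (@le_trans _ _ (B * (1 + `|x|) ^+ 2))//.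
        by rewrite expr2 mulrA ler_wpM2r// ltW.
      by rewrite (mulrC 4) -mulrA ler_wpM2l.
    rewrite -!mulrA !ler_wpM2l// (le_trans (hK x))// (ler_wpM2l (ltW K0))//.
    by apply: normal_pdf_ub; rewrite pnatr_eq0.
move=> /(congr1 fine)/=.
have := RintegralB measurableT ih' ixh; rewrite /Rintegral => -> /eqP.
by rewrite subr_eq0 => /eqP.
Qed.

Lemma std_normal_sqr_integral : \int[gamma]_x (x ^+ 2) = 1.
Proof.
rewrite (_ : (fun x : R => x ^+ 2) = (fun x => x * id x)); last first.
  by apply/funext => x; rewrite expr2.
rewrite (@std_normal_stein id (cst 1) 1).
- by rewrite Rintegral_cst// mul1r [X in fine X]probability_setT.
- by move=> x; exact: cst_continuous.
- by move=> x; rewrite mul1r lerDr.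
- by move=> x; rewrite normr1.
Qed.

Lemma continuous_normr_powR (q : R) : 0 < q ->
  continuous (fun x : R => `|x| `^ q).
Proof.
move=> q0 x; have [->|x0] := eqVneq x 0.
  rewrite /continuous_at normr0 powR0 ?gt_eqF//.
  apply/cvgr0Pnorm_lt => e e0; near=> y.
  have eE : (e `^ q^-1) `^ q = e by rewrite -powRrM mulVf ?gt_eqF// powRr1// ltW.
  rewrite ger0_norm ?powR_ge0// -[ltRHS]eE gt0_ltr_powR ?nnegrE ?powR_ge0//.
  by near: y; apply: (@pseudometric_normed_Zmodule.nbhs0_lt R R^o); rewrite powR_gt0.
apply: (@continuous_comp _ _ _ (fun y : R => `|y|) (fun y : R => y `^ q)).
  exact: norm_continuous.
have x1 : 0 < `|x| by rewrite normr_gt0.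
by have := is_derive1_powR q x1 => d; apply/differentiable_continuous/derivable1_diffP.
Unshelve. all: by end_near. Qed.

(** Substitution [t = x ^+ 2 / 2], first on bounded intervals, then by exhaustion of the half-line.
    The identity is between extended reals; finiteness is read off later from the Gaussian
    moment. *)
Lemma Gamma_integralE (s : R) : 0 < s ->
  (\int[mu]_(t in `]0%R, +oo[) (t `^ s * expR (- t))%:E =
   (2 `^ (- s))%:E * \int[mu]_(x in `[0%R, +oo[) (x `^ (2 * s + 1) * expR (- x ^+ 2 / 2))%:E)%E.
Proof.
move=> s0.
(* The absolute values make [G] and [H] continuous on the whole line without changing them on the
   half-line. *)
pose G (t : R) := `|t| `^ s * expR (- t).
pose H (x : R) := `|x| `^ (2 * s + 1) * expR (- x ^+ 2 / 2).
have cG : continuous G.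
  move=> t; apply: cvgM; first exact: continuous_normr_powR.
  apply: (continuous_comp (f := -%R) (g := expR)); first exact: oppr_continuous.
  exact: continuous_expR.
have cH : continuous H.
  move=> t; apply: cvgM.
    by apply: continuous_normr_powR; rewrite addr_gt0// mulr_gt0.
  apply: (@continuous_comp _ _ _ (fun x : R => - x ^+ 2 / 2) (expR)); last first.
    exact: continuous_expR.
  by apply: cvgM; [apply: cvgN; exact: exprn_continuous|exact: cvg_cst].
have G0 t : 0 <= G t by rewrite mulr_ge0 ?powR_ge0 ?expR_ge0.
have H0 t : 0 <= H t by rewrite mulr_ge0 ?powR_ge0 ?expR_ge0.
have mG : measurable_fun setT (G : measurableTypeR R -> R) by exact: continuous_measurable_fun.
have mH : measurable_fun setT (H : measurableTypeR R -> R) by exact: continuous_measurable_fun.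
have -> : (\int[mu]_(t in `]0%R, +oo[) (t `^ s * expR (- t))%:E =
    \int[mu]_(t in `[0%R, +oo[) (G t)%:E)%E.
  rewrite -integral_itv_obnd_cbnd; last exact/measurable_EFinP/measurable_funTS.
  by apply: eq_integral => t; rewrite inE/= in_itv/= andbT => t0; rewrite /G gtr0_norm.
have -> : (\int[mu]_(x in `[0%R, +oo[) (x `^ (2 * s + 1) * expR (- x ^+ 2 / 2))%:E =
    \int[mu]_(x in `[0%R, +oo[) (H x)%:E)%E.
  by apply: eq_integral => t; rewrite inE/= in_itv/= andbT => t0; rewrite /H ger0_norm.
pose F (x : R) := x ^+ 2 / 2.
have dF (x : R) : is_derive x (1 : R) F x.
  by apply: is_derive_eq; rewrite /GRing.scale/=; lra.
have cF : continuous F.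
  by move=> x; apply/differentiable_continuous/derivable1_diffP.
have F'E : derive1 F = id by apply/funext => x; rewrite derive1E derive_val.
have step n : (\int[mu]_(t in `[0%R, F n%:R]) (G t)%:E =
   (2 `^ (- s))%:E * \int[mu]_(x in `[0%R, n%:R]) (H x)%:E)%E.
  have F0 : F 0 = 0 by rewrite /F expr0n mul0r.
  rewrite -{1}F0 integration_by_substitution_increasing//.
  - rewrite -ge0_integralZl//; last 2 first.
    + by apply: measurable_funTS; exact/measurable_EFinP.
    + by move=> x _; rewrite lee_fin.
    apply: eq_integral => x; rewrite inE/= in_itv/= => /andP[x0 _].
    rewrite /G /H !fctE F'E -EFinM /F (ger0_norm x0); congr EFin.
    have x20 : 0 <= x ^+ 2 by exact: sqr_ge0.
    rewrite ger0_norm ?divr_ge0// powRM ?invr_ge0//.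
    have -> : x `^ (2 * s + 1) = (x ^+ 2) `^ s * x.
      rewrite powRD; last by rewrite gt_eqF// addr_gt0// mulr_gt0.
      by rewrite powRr1// powRrM powR_mulrn.
    have -> : 2^-1 `^ s = 2 `^ (- s) :> R.
      by rewrite -(powR_inv1 (ler0n _ 2)) -powRrM mulN1r.
    by rewrite mulNr; ring.
  - move=> x y; rewrite !in_itv/= => /andP[x0 _] /andP[y0 _] xy.
    by rewrite /F ltr_pM2r// ltrXn2r// ltW.
  - by rewrite F'E => x _; exact: cvg_id.
  - by rewrite F'E; apply/cvg_ex; exists 0; exact/cvg_at_right_filter/cvg_id.
  - by rewrite F'E; apply/cvg_ex; exists n%:R; exact/cvg_at_left_filter/cvg_id.
  - by split=> [x _||]; [|exact/cvg_at_right_filter/cF|exact/cvg_at_left_filter/cF].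
  - exact: continuous_subspaceT.
(* The lower bound [n / 2] covers both endpoint sequences in use, [n] and [n ^+ 2 / 2]. *)
have bigR (u : nat -> R) : (forall n, n%:R / 2 <= u n) ->
    \bigcup_n `[0, u n]%classic = `[0, +oo[%classic :> set R.
  move=> hu; apply/seteqP; split => x /=.
    by move=> [n _] /=; rewrite !in_itv/= andbT => /andP[].
  rewrite in_itv/= andbT => x0; exists (Num.truncn (2 * x)).+1 => //=.
  rewrite in_itv/= x0 (le_trans _ (hu _))// ler_pdivlMr// mulrC ltW//.
  exact: truncnS_gt.
have c1 : (\int[mu]_(t in `[0%R, F n%:R]) (G t)%:E @[n --> \oo] -->
    \int[mu]_(t in `[0%R, +oo[) (G t)%:E)%E.
  rewrite -(bigR (fun n => F n%:R)).
    apply: ge0_nondecreasing_set_cvg_integral => //.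
    - move=> m n mn; apply/subsetPset => x /=; rewrite !in_itv/= => /andP[-> /le_trans]; apply.
      by rewrite /F ler_pM2r// lerXn2r ?nnegrE// ler_nat.
    - by move=> n; exact/measurable_EFinP/measurable_funTS.
    - by move=> n x _; rewrite lee_fin.
  move=> [|n]; first by rewrite /F expr0n.
  by rewrite /F ler_pM2r// expr2 ler_peMr// ler1n.
have c2 : (\int[mu]_(t in `[0%R, n%:R]) (H t)%:E @[n --> \oo] -->
    \int[mu]_(t in `[0%R, +oo[) (H t)%:E)%E.
  rewrite -(bigR (fun n => n%:R)).
    apply: ge0_nondecreasing_set_cvg_integral => //.
    - move=> m n mn; apply/subsetPset => x /=; rewrite !in_itv/= => /andP[-> /le_trans]; apply.
      by rewrite ler_nat.
    - by move=> n; exact/measurable_EFinP/measurable_funTS.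
    - by move=> n x _; rewrite lee_fin.
  by move=> n; rewrite ler_pdivrMr// ler_peMr// ler1n.
have c3 : (\int[mu]_(t in `[0%R, F n%:R]) (G t)%:E @[n --> \oo] -->
    (2 `^ (- s))%:E * \int[mu]_(t in `[0%R, +oo[) (H t)%:E)%E.
  by rewrite (eq_cvg _ _ step); exact: cvgeZl.
exact: (cvg_unique _ c1 c3).
Qed.

Lemma normr_powR_le (s x : R) : 0 <= s <= 1 / 2 ->
  `|x| `^ (2 * s + 1) <= 1 + (s + 1 / 2) * (x ^+ 2 - 1).
Proof.
move=> /andP[s0 s1].
have -> : 2 * s + 1 = 2%:R * (s + 1 / 2) :> R by lra.
rewrite powRrM powR_mulrn// real_normK ?num_real//.
by apply: powR_le_tangent; [lra|exact: sqr_ge0].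
Qed.

Lemma measurable_normr_powR (q : R) :
  measurable_fun setT ((fun x => `|x| `^ q) : measurableTypeR R -> R).
Proof.
by apply: (@measurableT_comp _ _ _ _ _ _ (@powR R ^~ q)) => //; exact: measurable_normr.
Qed.

Lemma std_normal_abs_integrable (s : R) : 0 <= s <= 1 / 2 ->
  gamma.-integrable setT (EFin \o (fun x : R => `|x| `^ (2 * s + 1))).
Proof.
move=> s01; apply: (std_normal_integrable (C := 2)).
  exact: measurable_normr_powR.
move=> y; rewrite ger0_norm ?powR_ge0// (le_trans (normr_powR_le _ s01))//.
have := sqr_ge0 (y ^+ 2 - 1); have := sqr_ge0 y.
rewrite (_ : y ^+ 4 = y ^+ 2 ^+ 2); last by rewrite -exprM.
by move: s01 => /andP[? ?]; nra.
Qed.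

(** By symmetry the moment is twice an integral over the half-line, which [Gamma_integralE] turns
    into a value of Gamma; the powers of 2 and pi come from the normal peak and the substitution. *)
Lemma std_normal_abs_moment (s : R) : 0 < s <= 1 / 2 ->
  \int[gamma]_x (`|x| `^ (2 * s + 1)) =
  2 `^ (s + 1 / 2) * (pi `^ (- (1 / 2)) * Gamma (s + 1)).
Proof.
move=> /andP[s0 s1].
have : (\int[gamma]_x (`|x| `^ (2 * s + 1))%:E < +oo)%E.
  have /integrableP[_] : gamma.-integrable setT (EFin \o (fun x : R => `|x| `^ (2 * s + 1))).
    by apply: std_normal_abs_integrable; rewrite ltW.
  apply: le_lt_trans; apply: ge0_le_integral => //=.
  - apply/measurable_EFinP; exact: measurable_normr_powR.
  - by apply: measurableT_comp => //; apply: measurableT_comp => //; exact: measurable_normr_powR.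
  - by move=> x _; rewrite lee_fin ler_norm.
pose H (x : R) := `|x| `^ (2 * s + 1) * expR (- x ^+ 2 / 2).
have cH : continuous H.
  move=> t; apply: cvgM.
    by apply: continuous_normr_powR; rewrite addr_gt0// mulr_gt0.
  apply: (@continuous_comp _ _ _ (fun x : R => - x ^+ 2 / 2) expR); last first.
    exact: continuous_expR.
  by apply: cvgM; [apply: cvgN; exact: exprn_continuous|exact: cvg_cst].
have H0 t : 0 <= H t by rewrite mulr_ge0 ?powR_ge0 ?expR_ge0.
have mH : measurable_fun setT (H : measurableTypeR R -> R) by exact: continuous_measurable_fun.
have p0 : 0 < normal_peak (1 : R) by apply: normal_peak_gt0; rewrite oner_eq0.
have IE : (\int[gamma]_x (`|x| `^ (2 * s + 1))%:E =
    (normal_peak 1 * 2)%:E * \int[mu]_(x in `[0%R, +oo[) (x `^ (2 * s + 1) * expR (- x ^+ 2 / 2))%:E)%E.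
  have mq : measurable_fun setT (EFin \o (fun x => `|x| `^ (2 * s + 1)) : measurableTypeR R -> \bar R).
    by apply/measurable_EFinP; exact: measurable_normr_powR.
  rewrite (ge0_integral_normal_prob mq); last by move=> x; rewrite lee_fin powR_ge0.
  under eq_integral do rewrite -EFinM std_normal_pdfE mulrCA EFinM.
  rewrite (ge0_integralZl mu measurableT ((measurable_EFinP _ _).2 mH)); last 2 first.
  - by move=> x _; rewrite lee_fin H0.
  - by rewrite lee_fin ltW.
  rewrite EFinM -muleA; congr (_ * _)%E.
  rewrite (ge0_symfun_integralT H0 cH); last first.
    by move=> x; rewrite /H /= normrN sqrrN.
  congr (_ * _)%E; rewrite set_itvcy.
  by apply: eq_integral => t; rewrite inE/= => t0; rewrite /H ger0_norm.
rewrite /Rintegral /Gamma IE /Rintegral.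
under [in RHS]eq_integral do rewrite addrK.
rewrite Gamma_integralE//.
set K := (\int[mu]_(x in _) _)%E.
have : (0 <= K)%E.
  by apply: integral_ge0 => x _; rewrite lee_fin mulr_ge0 ?powR_ge0 ?expR_ge0.
(* The moment is finite, which excludes an infinite [K]; [fine] then commutes with the products. *)
case: K => [k| |]// k0; last by rewrite gt0_muley ?lte_fin ?mulr_gt0.
rewrite -!EFinM/= => _.
rewrite !mulrA; congr (_ * k).
rewrite /normal_peak expr1n mul1r -mulr_natr.
have pi0 := pi_gt0 R.
rewrite -powR12_sqrt ?mulr_ge0 ?ltW// powRM ?ltW// mul1r !powRN.
rewrite powRD; last by rewrite pnatr_eq0 implybT.
have e : 2 `^ (2^-1) * 2 `^ (2^-1) = 2 :> R.
  rewrite -powRD; last by rewrite pnatr_eq0 implybT.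
  have -> : 2^-1 + 2^-1 = 1 :> R by lra.
  by rewrite powRr1.
have a0 : 0 < 2 `^ (2^-1) :> R by rewrite powR_gt0.
have b0 : 0 < pi `^ (2^-1) :> R by rewrite powR_gt0.
have c0 : 0 < 2 `^ s :> R by rewrite powR_gt0.
rewrite -[X in _ * X = _]e; field.
by rewrite ?gt_eqF.
Qed.

(** The tangent bound [normr_powR_le] integrates to exactly 1 because the second moment is 1. *)
Lemma std_normal_abs_moment_le1 (s : R) : 0 <= s <= 1 / 2 ->
  \int[gamma]_x (`|x| `^ (2 * s + 1)) <= 1.
Proof.
move=> s01.
have i2 : gamma.-integrable setT (EFin \o (fun x : R => x ^+ 2)).
  apply: (std_normal_integrable (C := 1)).
    exact: measurable_funX.
  move=> y; rewrite ger0_norm ?sqr_ge0// (_ : y ^+ 4 = y ^+ 2 ^+ 2); last by rewrite -exprM.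
  by have := sqr_ge0 (y ^+ 2 - 1); have := sqr_ge0 y; nra.
have ic (c : R) : gamma.-integrable setT (EFin \o (fun x : R => c)).
  exact: finite_measure_integrable_cst.
have i3 : gamma.-integrable setT (EFin \o (fun x : R => (s + 1 / 2) * (x ^+ 2 - 1))).
  exact: (integrableZl measurableT (s + 1 / 2) (integrableB measurableT i2 (ic 1))).
apply: (@le_trans _ _ (\int[gamma]_x (1 + (s + 1 / 2) * (x ^+ 2 - 1)))).
  apply: le_Rintegral => //; first exact: std_normal_abs_integrable.
    exact: (integrableD measurableT (ic 1) i3).
  by move=> x _; exact: normr_powR_le.
rewrite RintegralD// RintegralZl//; last exact: (integrableB measurableT i2 (ic 1)).
rewrite RintegralB// std_normal_sqr_integral !Rintegral_cst// !mul1r.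
by rewrite [X in fine X]probability_setT/= subrr mulr0 addr0.
Qed.

End gaussian_moments.

(** * Rounding the real line *)

Section finite_range.
Context {R : realType} {disp : measure_display} {T : measurableType disp}.
Variables (P : probability T R) (V : finType) (c : T -> V).
Hypothesis mc : forall v, measurable (c @^-1` [set v]).

Let fE (f : V -> R) (t : T) :
  f (c t) = \sum_(v : V) f v * \1_(c @^-1` [set v]) t.
Proof.
rewrite (bigD1 (c t))//= big1 ?addr0 => [|v vc].
  by rewrite indicE mem_set// mulr1.
by rewrite indicE memNset ?mulr0//= => cv; rewrite cv eqxx in vc.
Qed.

Lemma measurable_finite_range (f : V -> R) : measurable_fun setT (fun t => f (c t)).
Proof.
rewrite (_ : (fun t => _) = (fun t => \sum_(v : V) f v * \1_(c @^-1` [set v]) t)).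
  by apply: measurable_sum => v; apply: measurable_funM.
by apply/funext => t; exact: fE.
Qed.

Let integrable_term (f : V -> R) v : P.-integrable setT
  (fun t => (f v * \1_(c @^-1` [set v]) t)%:E).
Proof.
apply: (@eq_integrable _ _ _ _ _ measurableT
  (fun t => ((f v)%:E * (\1_(c @^-1` [set v]) t)%:E)%E)) => //.
by apply: integrableZl => //; exact: integrable_indic.
Qed.

Lemma integrable_finite_range (f : V -> R) :
  P.-integrable setT (fun t => (f (c t))%:E).
Proof.
apply: (@eq_integrable _ _ _ _ _ measurableT
  (fun t => (\sum_(v : V) (f v * \1_(c @^-1` [set v]) t)%:E)%E)).
  by move=> t _; rewrite sumEFin -fE.
by apply: integrable_sum => // v _; exact: integrable_term.
Qed.

Lemma integral_finite_range (f : V -> R) :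
  (\int[P]_t (f (c t))%:E =
   (\sum_(v : V) fine (P (c @^-1` [set v])) * f v)%:E)%E.
Proof.
under eq_integral do rewrite fE -sumEFin.
rewrite integral_sum//.
rewrite -sumEFin; apply: eq_bigr => v _.
under eq_integral do rewrite EFinM.
rewrite integralZl//; last exact: integrable_indic.
rewrite integral_indic// setIT EFinM fineK; first by rewrite muleC.
exact: fin_num_measure.
Qed.

End finite_range.

(** * Quantizers of the line and an approximate Stein identity *)

Section quantizer.
Context {R : realType}.
Local Notation gamma := (@normal_prob R 0 1).

(* [qval_le] asks for rounding towards zero, so that absolute moments of the
   normal law can only decrease. *)
Record quantizer := Quantizer {
  qT : finType;
  qcell : measurableTypeR R -> qT;
  qval : qT -> R;
  measurable_qcell : forall v, measurable (qcell @^-1` [set v]);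
  qval_le : forall y, `|qval (qcell y)| <= `|y| }.

Definition quant (Q : quantizer) (y : R) := qval (qcell Q y).

Definition qweight (Q : quantizer) (v : qT Q) : R :=
  fine (gamma (qcell Q @^-1` [set v])).

(** The weight [1 + |y|] matches the modulus of continuity of [y * h y] for bounded Lipschitz
    [h]. *)
Definition qerror (Q : quantizer) : R :=
  \int[gamma]_y ((1 + `|y|) * `|y - quant Q y|).

Lemma qweight_ge0 (Q : quantizer) v : 0 <= @qweight Q v.
Proof. by apply: fine_ge0; exact: measure_ge0. Qed.

Lemma qsumE (Q : quantizer) (f : R -> R) :
  \sum_v qweight v * f (@qval Q v) = \int[gamma]_y f (quant Q y).
Proof.
have := integral_finite_range gamma (@measurable_qcell Q) (fun v => f (qval v)).
by rewrite /Rintegral => ->.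
Qed.

Lemma qweight_sum (Q : quantizer) : \sum_v @qweight Q v = 1.
Proof.
have := qsumE Q (fun=> 1).
under eq_bigr do rewrite mulr1.
by move=> ->; rewrite Rintegral_cst// mul1r [X in fine X]probability_setT.
Qed.

Lemma integrable_quant (Q : quantizer) (f : R -> R) :
  gamma.-integrable setT (EFin \o (fun y => f (quant Q y))).
Proof. exact: (integrable_finite_range gamma (@measurable_qcell Q) (fun v => f (qval v))). Qed.

Lemma measurable_quant (Q : quantizer) (f : R -> R) :
  measurable_fun setT ((fun y => f (quant Q y)) : measurableTypeR R -> R).
Proof. exact: (measurable_finite_range (@measurable_qcell Q) (fun v => f (qval v))). Qed.

Lemma measurable_qerror (Q : quantizer) : measurable_fun setT
  ((fun y => (1 + `|y|) * `|y - quant Q y|) : measurableTypeR R -> R).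
Proof.
apply: measurable_funM; first by apply: measurable_funD => //; exact: measurable_normr.
apply: measurableT_comp => //; apply: measurable_funB => //.
exact: (measurable_quant Q id).
Qed.

Lemma integrable_qerror (Q : quantizer) : gamma.-integrable setT
  (EFin \o (fun y => (1 + `|y|) * `|y - quant Q y|)).
Proof.
apply: (std_normal_integrable (C := 8)); first exact: measurable_qerror.
move=> y; rewrite normrM normr_id ger0_norm ?addr_ge0//.
have h : `|y - quant Q y| <= 2 * `|y|.
  rewrite (le_trans (ler_normB _ _))// mulr_natl mulr2n lerD2l; exact: qval_le.
rewrite (le_trans (ler_wpM2l _ h)) ?addr_ge0//.
have -> : y ^+ 4 = (`|y| ^+ 2) ^+ 2 by rewrite real_normK ?num_real// -exprM.
have := normr_ge0 y; have := sqr_ge0 (`|y| - 1); have := sqr_ge0 (`|y| ^+ 2 - 1).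
nra.
Qed.

Lemma qerror_ge0 (Q : quantizer) : 0 <= qerror Q.
Proof. by apply: Rintegral_ge0 => y _; rewrite mulr_ge0 ?addr_ge0. Qed.

(** Stein's identity is exact for the normal law, so only rounding contributes: moving [y] to [q]
    changes [y * h y] by at most [G * (1 + |y|) * |y - q|] and [h' y] by at most [G * |y - q|]. *)
Lemma quantizer_stein (Q : quantizer) (h h' : R -> R) (G : R) :
  (forall x : R, is_derive x (1 : R) h (h' x)) ->
  (forall x, `|h x| <= G) -> (forall x, `|h' x| <= G) ->
  (forall x y, `|h x - h y| <= G * `|x - y|) ->
  (forall x y, `|h' x - h' y| <= G * `|x - y|) ->
  `|\sum_v qweight v * (qval v * h (@qval Q v)) -
    \sum_v qweight v * h' (@qval Q v)| <= 2 * G * qerror Q.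
Proof.
move=> dh hG h'G hL h'L.
have G0 : 0 <= G by exact: le_trans (hG 0).
have ch : continuous h.
  by move=> x; apply/differentiable_continuous/derivable1_diffP.
have ch' : continuous h'.
  move=> x; apply/cvgrPdist_le => e e0.
  have G1 : 0 < G + 1 by rewrite ltr_wpDl.
  near=> y; rewrite (le_trans (h'L _ _))//.
  rewrite (@le_trans _ _ ((G + 1) * `|x - y|))//; first by rewrite ler_wpM2r// lerDl.
  rewrite mulrC -ler_pdivlMr//; near: y.
  by apply: cvgr_dist_le => //; rewrite divr_gt0.
rewrite (qsumE Q (fun y => y * h y)) (qsumE Q h').
have st : \int[gamma]_x (x * h x) = \int[gamma]_x h' x.
  apply: (std_normal_stein dh ch' _ h'G) => x.
  by rewrite (le_trans (hG x))// ler_peMr// lerDl.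
have mh : measurable_fun setT (h : measurableTypeR R -> R) by exact: continuous_measurable_fun.
have mh' : measurable_fun setT (h' : measurableTypeR R -> R) by exact: continuous_measurable_fun.
have i1 : gamma.-integrable setT (EFin \o (fun x => x * h x)).
  apply: (std_normal_integrable (C := G)); first exact: measurable_funM.
  move=> y; rewrite normrM mulrC ler_pM//.
  have -> : y ^+ 4 = (`|y| ^+ 2) ^+ 2 by rewrite real_normK ?num_real// -exprM.
  by have := sqr_ge0 (`|y| - 1); have := sqr_ge0 (`|y| ^+ 2 - 1); nra.
have i2 : gamma.-integrable setT (EFin \o h').
  apply: (std_normal_integrable (C := G)) => // y.
  by rewrite (le_trans (h'G y))// ler_peMr// lerDl exprn_even_ge0.
have i3 := integrable_quant Q (fun y => y * h y).
have i4 := integrable_quant Q h'.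
have i5 := integrableB measurableT i3 i1.
have i6 := integrableB measurableT i4 i2.
have i7 := integrableB measurableT i5 i6.
rewrite (_ : _ - _ = \int[gamma]_y
    ((quant Q y * h (quant Q y) - y * h y) - (h' (quant Q y) - h' y))); last first.
  rewrite RintegralB// RintegralB// RintegralB// st; ring.
rewrite (le_trans (le_normr_Rintegral measurableT i7))//.
rewrite /qerror -RintegralZl//; last exact: integrable_qerror.
apply: le_Rintegral => //.
- exact: integrable_norm.
- exact: (integrableZl measurableT (2 * G) (integrable_qerror Q)).
move=> y _ /=; rewrite (le_trans (ler_normB _ _))//.
set q := quant Q y.
have -> : q * h q - y * h y = - ((y - q) * h q) + - (y * (h y - h q)) by ring.
rewrite (le_trans (lerD (ler_normD _ _) (h'L _ _)))// !normrN !normrM.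
have e1 : `|y - q| * `|h q| <= `|y - q| * G by rewrite ler_wpM2l.
have e2 : `|y| * `|h y - h q| <= `|y| * (G * `|y - q|) by rewrite ler_wpM2l.
rewrite (distrC q y); move: e1 e2.
set a := `|y - q|; set b := `|y|; set c1 := `|h q|; set c2 := `|h y - h q|.
have : 0 <= a * b * G by rewrite !mulr_ge0 ?normr_ge0.
by lra.
Unshelve. all: by end_near. Qed.

Lemma exists_quantizer (d : R) : 0 < d -> exists Q, qerror Q <= d.
Proof.
move=> d0.
pose C := \int[gamma]_y (8 * (1 + y ^+ 4)).
have iC : gamma.-integrable setT (EFin \o (fun y : R => 8 * (1 + y ^+ 4))).
  apply: (std_normal_integrable (C := 8)).
    by apply: measurable_funM => //; apply: measurable_funD => //; exact: measurable_funX.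
  by move=> y; rewrite ger0_norm// mulr_ge0// addr_ge0// exprn_even_ge0.
have C0 : 0 <= C.
  by apply: Rintegral_ge0 => y _; rewrite mulr_ge0// addr_ge0// exprn_even_ge0.
pose m := (Num.truncn (C / d)).+1.
have m0 : 0 < m%:R :> R by rewrite ltr0n.
have Cm : C / m%:R <= d.
  by rewrite ler_pdivrMr// mulrC -ler_pdivrMr// ltW// truncnS_gt.
(* Steps of length [1 / m] up to modulus [m], beyond which values are truncated: [m ^ 2] steps in
   each direction. *)
pose N := (m ^ 2)%N.
pose V := (bool * 'I_N.+1)%type.
pose idx (y : R) : 'I_N.+1 := inord (minn (Num.truncn (m%:R * `|y|)) N).
pose cell (y : measurableTypeR R) : V := (y < 0, idx y).
pose value (v : V) : R := (-1) ^+ v.1 * (v.2%:R / m%:R).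
have idxE (y : R) : idx y = minn (Num.truncn (m%:R * `|y|)) N :> nat.
  by rewrite inordK// ltnS geq_minr.
have my0 (y : R) : 0 <= m%:R * `|y| by rewrite mulr_ge0.
have tl (y : R) : (Num.truncn (m%:R * `|y|))%:R <= m%:R * `|y| by rewrite truncn_le my0.
have idx_le (y : R) : (idx y)%:R / m%:R <= `|y|.
  rewrite ler_pdivrMr// mulrC idxE (le_trans _ (tl y))//.
  by rewrite ler_nat geq_minl.
have mabs : measurable_fun setT ((fun y => m%:R * `|y|) : measurableTypeR R -> R).
  by apply: measurable_funM => //; exact: measurable_normr.
have mcell v : measurable (cell @^-1` [set v]).
  case: v => b j.
  rewrite (_ : _ @^-1` _ = \bigcup_(k in [set k | inord (minn k N) = j])
     ((fun y : measurableTypeR R => y < 0) @^-1` [set b] `&`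
      (fun y => m%:R * `|y|) @^-1` `[k%:R, k.+1%:R[%classic)).
    apply: bigcup_measurable => k _; apply: measurableI; last first.
      by rewrite -[X in measurable X]setTI; exact: mabs.
    case: b.
      by rewrite (_ : _ @^-1` _ = `]-oo, 0[%classic).
    rewrite (_ : _ @^-1` _ = `[0, +oo[%classic)//.
    by apply/seteqP; split => x /=; rewrite in_itv/= andbT leNgt; [move=> ->|move=> /negbTE].
  apply/seteqP; split => y /=.
    move=> [<- <-]; exists (Num.truncn (m%:R * `|y|)) => //=; split => //.
    by rewrite in_itv/= tl truncnS_gt.
  move=> [k /= kj [yb]]; rewrite in_itv/= => /truncn_def kE.
  by rewrite /cell /idx yb kE kj.
have value_le y : `|value (cell y)| <= `|y|.
  rewrite /value normrM normr_sign mul1r ger0_norm ?divr_ge0//; exact: idx_le.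
exists (Quantizer mcell value_le).
apply: le_trans Cm; rewrite mulrC -RintegralZl//.
apply: le_Rintegral => //.
- exact: integrable_qerror.
- exact: (integrableZl measurableT (m%:R^-1) iC).
move=> y _ /=.
(* Below the cutoff the error is at most [1 / m]; beyond it [m <= |y|], so the error is at most
   [|y| <= |y| ^+ 2 / m]. *)
have dist : `|y - value (cell y)| <= (1 + `|y| ^+ 2) / m%:R.
  have -> : `|y - value (cell y)| = `|y| - (idx y)%:R / m%:R.
    rewrite /value/=; have := idx_le y; set j := _ / _.
    case: ltP => y0 jy; rewrite ?expr0 ?expr1 ?mul1r ?mulN1r.
      rewrite ltr0_norm// in jy *.
      by rewrite opprK ler0_norm; lra.
    by rewrite ger0_norm in jy *; rewrite ?ger0_norm//; lra.
  rewrite ler_pdivlMr// mulrBl divfK ?gt_eqF//.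
  have := truncnS_gt (m%:R * `|y|).
  rewrite idxE; have [_ h|Nt _] := leqP (Num.truncn (m%:R * `|y|)) N.
    rewrite -natr1 in h; have := sqr_ge0 `|y|; lra.
  have : N%:R <= m%:R * `|y|.
    by rewrite (le_trans _ (tl y))// ler_nat ltnW.
  rewrite /N natrX expr2 ler_pM2l// => my.
  have := ler_wpM2r (normr_ge0 y) my; rewrite -expr2.
  have : 0 <= m%:R ^+ 2 :> R by exact: sqr_ge0.
  lra.
rewrite (le_trans (ler_wpM2l _ dist)) ?addr_ge0//.
rewrite [leLHS]mulrA [leLHS]mulrC ler_pM2l ?invr_gt0//.
have -> : y ^+ 4 = (`|y| ^+ 2) ^+ 2 by rewrite real_normK ?num_real// -exprM.
have := normr_ge0 y; have := sqr_ge0 (`|y| - 1); have := sqr_ge0 (`|y| ^+ 2 - 1).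
set a := `|y|; have := sqr_ge0 (a ^+ 2 - a).
nra.
Qed.

End quantizer.

(** * Log-sum-exp *)

Lemma is_derive_bigsum (R : realType) (I : Type) (s : seq I) (h : I -> R -> R)
    (dh : I -> R) (x : R) :
  (forall i, is_derive x (1 : R) (h i) (dh i)) ->
  is_derive x (1 : R) (fun y => \sum_(i <- s) h i y) (\sum_(i <- s) dh i).
Proof.
move=> H; elim: s => [|i s IH].
  rewrite big_nil (_ : (fun y => _) = cst 0); first exact: is_derive_cst.
  by apply/funext => y; rewrite big_nil.
rewrite big_cons (_ : (fun y => _) = (fun y => h i y + \sum_(j <- s) h j y)).
  exact: is_deriveD.
by apply/funext => y; rewrite big_cons.
Qed.

Section softmax.
Context {R : realType} {T : finType}.
Variable b : R.
Implicit Types (f z : T -> R).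

(** With the weights [expR (b * z t)] normalised, [softavg] is the average under the Gibbs law at
    inverse temperature [b]; [logsumexp] is the corresponding free energy, a smooth approximation of
    the maximum of [z]. *)
Definition expsum f z := \sum_t f t * expR (b * z t).
Definition softavg f z := expsum f z / expsum (fun=> 1) z.
Definition logsumexp z := b^-1 * ln (expsum (fun=> 1) z).

Lemma expsum1_gt0 (t0 : T) z : 0 < expsum (fun=> 1) z.
Proof.
rewrite /expsum (bigD1 t0)//= ltr_wpDr ?mul1r ?expR_gt0//.
by apply: sumr_ge0 => t _; rewrite mul1r expR_ge0.
Qed.

Lemma le_expsum f g z : (forall t, f t <= g t) -> expsum f z <= expsum g z.
Proof. by move=> fg; apply: ler_sum => t _; rewrite ler_wpM2r ?expR_ge0. Qed.

Lemma expsumD f g z : expsum (fun t => f t + g t) z = expsum f z + expsum g z.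
Proof. by rewrite -big_split/=; apply: eq_bigr => t _; rewrite mulrDl. Qed.

Lemma expsumZ c f z : expsum (fun t => c * f t) z = c * expsum f z.
Proof. by rewrite mulr_sumr; apply: eq_bigr => t _; rewrite mulrA. Qed.

Lemma softavgD f g z :
  softavg (fun t => f t + g t) z = softavg f z + softavg g z.
Proof. by rewrite /softavg expsumD mulrDl. Qed.

Lemma softavgZ c f z : softavg (fun t => c * f t) z = c * softavg f z.
Proof. by rewrite /softavg expsumZ mulrA. Qed.

Lemma softavg_cst (t0 : T) c z : softavg (fun=> c) z = c.
Proof.
rewrite (_ : (fun _ : T => c) = (fun t => c * 1)); last first.
  by apply/funext => t; rewrite mulr1.
by rewrite (softavgZ c (fun=> 1)) /softavg divff ?mulr1// gt_eqF// (expsum1_gt0 t0).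
Qed.

Lemma le_softavg (t0 : T) f g z :
  (forall t, f t <= g t) -> softavg f z <= softavg g z.
Proof.
by move=> fg; rewrite ler_pM2r ?le_expsum// invr_gt0 (expsum1_gt0 t0).
Qed.

Lemma softavg_norm_le (t0 : T) f z G :
  (forall t, `|f t| <= G) -> `|softavg f z| <= G.
Proof.
move=> fG; rewrite ler_norml -{1}(softavg_cst t0 (- G) z) -{2}(softavg_cst t0 G z).
by apply/andP; split; apply: (le_softavg t0) => t; have := fG t; rewrite ler_norml => /andP[].
Qed.

Lemma logsumexp_ge (t : T) z : 0 < b -> z t <= logsumexp z.
Proof.
move=> b0; rewrite /logsumexp ler_pdivlMl// -ler_expR lnK ?posrE ?(expsum1_gt0 t)//.
rewrite /expsum (bigD1 t)//= mul1r lerDl.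
by apply: sumr_ge0 => u _; rewrite mul1r expR_ge0.
Qed.

(** Each of the [#|T|] exponentials is at most [expR (b * M)]. Together with [logsumexp_ge], the
    smooth maximum exceeds the true one by at most [ln #|T| / b]. *)
Lemma logsumexp_le (t0 : T) z M : 0 < b -> (forall t, z t <= M) ->
  logsumexp z <= M + ln #|T|%:R / b.
Proof.
move=> b0 zM; rewrite /logsumexp ler_pdivrMl// mulrDr mulrCA divff ?gt_eqF// mulr1.
have T0 : 0 < #|T|%:R :> R by rewrite ltr0n; apply/card_gt0P; exists t0.
rewrite -ler_expR lnK ?posrE ?(expsum1_gt0 t0)// expRD lnK ?posrE//.
rewrite mulrC mulr_natl -sumr_const.
by apply: ler_sum => t _; rewrite mul1r ler_expR ler_pM2l.
Qed.

(** Moving [z] by at most [e] multiplies each unnormalised weight by a factor between [exp (- b e)]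
    and [exp (b e)], hence the average of a nonnegative [f] by at least
    [exp (- 2 b e) >= 1 - 2 b e]. *)
Lemma ge0_softavg_lipschitz (t0 : T) f z z' e G : 0 <= b ->
  (forall t, 0 <= f t <= G) -> (forall t, `|z t - z' t| <= e) ->
  softavg f z' - softavg f z <= 2 * b * e * G.
Proof.
move=> b0 fG ze.
have G0 : 0 <= G by have /andP[/le_trans] := fG t0; apply.
have e0 : 0 <= e by exact: le_trans (ze t0).
have D0 := expsum1_gt0 t0.
have dir z1 z2 g : (forall t, 0 <= g t) -> (forall t, `|z1 t - z2 t| <= e) ->
    expR (- (b * e)) * expsum g z1 <= expsum g z2.
  move=> g0 z12; rewrite mulr_sumr; apply: ler_sum => t _.
  rewrite mulrCA ler_wpM2l// -expRD ler_expR -mulrN -mulrDr ler_wpM2l//.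
  by have := z12 t; rewrite ler_norml => /andP[_]; lra.
have f0 t : 0 <= f t by have /andP[] := fG t.
have h1 : expR (- (b * e)) * expsum f z' <= expsum f z.
  by apply: dir => // t; rewrite distrC.
have h2 : expR (- (b * e)) * expsum (fun=> 1) z <= expsum (fun=> 1) z'.
  by apply: dir.
have avg0 : 0 <= softavg f z' <= G.
  rewrite -{1}(softavg_cst t0 0 z') -(softavg_cst t0 G z') !(le_softavg t0)// => t.
  by have /andP[] := fG t.
have key : expR (- (2 * (b * e))) * softavg f z' <= softavg f z.
  rewrite /softavg ler_pdivlMr// -!mulrA.
  rewrite (_ : - (2 * (b * e)) = - (b * e) + - (b * e)); last by ring.
  rewrite expRD -mulrA (le_trans _ h1)// ler_wpM2l ?expR_ge0//.
  rewrite mulrCA ler_piMr ?sumr_ge0// => [t _|]; first by rewrite mulr_ge0 ?expR_ge0.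
  by rewrite mulrCA ler_pdivrMl// mulr1.
have h3 : 1 - 2 * (b * e) <= expR (- (2 * (b * e))) by exact: expR_ge1Dx.
move: avg0 => /andP[a0 aG].
have : (1 - 2 * (b * e)) * softavg f z' <= softavg f z.
  by rewrite (le_trans _ key)// ler_wpM2r.
have := ler_wpM2l (mulr_ge0 b0 e0) aG.
lra.
Qed.

(** Shifting [f] by [G] makes it nonnegative and at most [2 * G], which doubles the constant of
    [ge0_softavg_lipschitz]. *)
Lemma softavg_lipschitz (t0 : T) f z z' e G : 0 <= b ->
  (forall t, `|f t| <= G) -> (forall t, `|z t - z' t| <= e) ->
  `|softavg f z - softavg f z'| <= 4 * b * e * G.
Proof.
move=> b0 fG ze.
have h z1 z2 : (forall t, `|z1 t - z2 t| <= e) ->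
    softavg f z2 - softavg f z1 <= 4 * b * e * G.
  move=> z12; have := @ge0_softavg_lipschitz t0 (fun t => f t + G) z1 z2 e (2 * G) b0.
  rewrite !softavgD !(softavg_cst t0) => h; rewrite (le_trans _ (le_trans (h _ z12) _))//.
  - lra.
  - by move=> t; have := fG t; rewrite ler_norml => /andP[? ?]; lra.
  - by rewrite le_eqVlt; apply/orP; left; apply/eqP; ring.
by rewrite ler_norml; apply/andP; split; [have := h _ _ ze; lra|apply: h => t; rewrite distrC].
Qed.

Section along_a_path.
Variables (t0 : T) (z : R -> T -> R) (dz : T -> R) (x : R).
Hypothesis b0 : 0 < b.
Hypothesis zd : forall t, is_derive x (1 : R) (fun y => z y t) (dz t).

Lemma is_derive_expsum f :
  is_derive x (1 : R) (fun y => expsum f (z y)) (b * expsum (fun t => f t * dz t) (z x)).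
Proof.
apply: (is_derive_eq (f' := \sum_t f t * (b * dz t * expR (b * z x t)))).
  apply: is_derive_bigsum => t; have := zd t => d.
  by apply: is_derive_eq; rewrite /GRing.scale/=; ring.
by rewrite mulr_sumr; apply: eq_bigr => t _; ring.
Qed.

Lemma is_derive_logsumexp :
  is_derive x (1 : R) (fun y => logsumexp (z y)) (softavg dz (z x)).
Proof.
have D0 := expsum1_gt0 t0 (z x).
have d := is_derive_expsum (fun=> 1).
have dl := is_derive1_ln D0.
have dc := @is_derive1_comp R (@ln R) (fun y => expsum (fun=> 1) (z y)) x _ _ dl d.
apply: (is_derive_eq (is_deriveZ b^-1 dc)); rewrite /GRing.scale/=.
rewrite (_ : (fun t => 1 * dz t) = dz); last by apply/funext => t; rewrite mul1r.
rewrite /softavg; field.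
by rewrite !gt_eqF.
Qed.

(** The derivative of a Gibbs average is [b] times the Gibbs covariance of [f] with the velocity
    [dz]. *)
Lemma is_derive_softavg f :
  is_derive x (1 : R) (fun y => softavg f (z y))
    (b * (softavg (fun t => f t * dz t) (z x) - softavg f (z x) * softavg dz (z x))).
Proof.
have D0 := expsum1_gt0 t0 (z x).
have d1 := is_derive_expsum (fun=> 1).
have d2 := is_derive_expsum f.
have dV := is_deriveV (lt0r_neq0 D0) d1.
apply: (is_derive_eq (is_deriveM d2 dV)).
rewrite (_ : (fun t => 1 * dz t) = dz); last by apply/funext => t; rewrite mul1r.
rewrite /softavg /GRing.scale/=; field.
by rewrite gt_eqF.
Qed.

End along_a_path.
End softmax.

(** * Interpolation between two processes *)

Section quantized_expectation.
Context {R : realType} (Q : quantizer (R := R)).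
Implicit Types (K : finType).

(** Expectation over independent coordinates, each following the rounded normal law; independence is
    the product of the weights. *)
Definition qexp K (f : (K -> R) -> R) : R :=
  \sum_(v : {ffun K -> qT Q}) (\prod_k qweight (v k)) * f (fun k => qval (v k)).

Definition update K (x : K -> R) (k : K) (y : R) : K -> R :=
  fun j => if j == k then y else x j.

Lemma qexpD K (f g : (K -> R) -> R) :
  qexp (fun x => f x + g x) = qexp f + qexp g.
Proof. by rewrite -big_split; apply: eq_bigr => v _; rewrite mulrDr. Qed.

Lemma qexpZ K c (f : (K -> R) -> R) : qexp (fun x => c * f x) = c * qexp f.
Proof. by rewrite mulr_sumr; apply: eq_bigr => v _; rewrite mulrCA. Qed.

Lemma qexp_sum K I (s : seq I) (f : I -> (K -> R) -> R) :
  qexp (fun x => \sum_(i <- s) f i x) = \sum_(i <- s) qexp (f i).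
Proof. by rewrite exchange_big; apply: eq_bigr => v _; rewrite mulr_sumr. Qed.

Let weight_ge0 K (v : {ffun K -> qT Q}) : 0 <= \prod_k qweight (v k).
Proof. by apply: prodr_ge0 => k _; exact: qweight_ge0. Qed.

Lemma le_qexp K (f g : (K -> R) -> R) : (forall x, f x <= g x) ->
  qexp f <= qexp g.
Proof. by move=> fg; apply: ler_sum => v _; rewrite ler_wpM2l. Qed.

Lemma qexpB K (f g : (K -> R) -> R) :
  qexp (fun x => f x - g x) = qexp f - qexp g.
Proof. by rewrite -sumrB; apply: eq_bigr => v _; rewrite mulrBr. Qed.

Lemma qexp_cst K c : qexp (fun _ : K -> R => c) = c.
Proof.
rewrite /qexp -mulr_suml -(bigA_distr_bigA (fun (k : K) (v : qT Q) => qweight v)).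
by rewrite big1 ?mul1r// => k _; rewrite qweight_sum.
Qed.

Lemma qexp_norm_le K (f : (K -> R) -> R) c :
  (forall x, `|f x| <= c) -> `|qexp f| <= c.
Proof.
move=> fc; rewrite ler_norml -{1}(qexp_cst K (- c)) -{2}(qexp_cst K c).
by apply/andP; split; apply: le_qexp => x; have := fc x; rewrite ler_norml => /andP[].
Qed.

Lemma qexp_fubini K (k : K) (f : (K -> R) -> R) :
  qexp f = qexp (fun x => \sum_a qweight a * f (update x k (@qval _ Q a))).
Proof.
(* Exchanging the [k]-th coordinate with the resampled one preserves weights. *)
pose swap (p : {ffun K -> qT Q} * qT Q) :=
  ([ffun j => if j == k then p.2 else p.1 j], p.1 k).
have swapK : involutive swap.
  move=> [v a]; rewrite /swap/= ffunE eqxx; congr pair.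
  by apply/ffunP => j; rewrite !ffunE/=; case: eqP => // ->.
rewrite /qexp; under [RHS]eq_bigr do rewrite mulr_sumr.
rewrite pair_big/= (reindex_inj (inv_inj swapK))/=.
transitivity (\sum_(p : {ffun K -> qT Q} * qT Q)
  qweight p.2 * ((\prod_j qweight (p.1 j)) * f (fun j => qval (p.1 j)))).
  rewrite -(pair_big xpredT xpredT (fun (v : {ffun K -> qT Q}) a =>
     qweight a * ((\prod_j qweight (v j)) * f (fun j => qval (v j)))))/=.
  by apply: eq_bigr => v _; rewrite -mulr_suml qweight_sum mul1r.
apply: eq_bigr => -[v a] _ /=.
have -> : update (fun j => qval ([ffun j0 => if j0 == k then a else v j0] j)) k
    (qval (v k)) = (fun j => qval (v j)).
  by apply/funext => j; rewrite /update ffunE; case: eqP => [->|].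
rewrite !mulrA; congr (_ * _).
rewrite (bigD1 k)//= [in RHS](bigD1 k)//= ffunE eqxx.
rewrite [X in _ = _ * X * _](eq_bigr (fun j => qweight (v j))).
  by ring.
by move=> j /negbTE jk; rewrite ffunE jk.
Qed.

Lemma qexp_coord K (k : K) (g : R -> R) :
  qexp (fun x => g (x k)) = \sum_a qweight a * g (@qval _ Q a).
Proof.
rewrite (qexp_fubini k) -[RHS](qexp_cst K); congr qexp.
by apply/funext => x; apply: eq_bigr => a _; rewrite /update eqxx.
Qed.

Lemma qexp_inl K1 K2 (f : (K1 -> R) -> R) :
  qexp (fun x : K1 + K2 -> R => f (fun k => x (inl k))) = qexp f.
Proof.
pose glue (p : {ffun K1 -> qT Q} * {ffun K2 -> qT Q}) : {ffun K1 + K2 -> qT Q} :=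
  [ffun k => match k with inl i => p.1 i | inr i => p.2 i end].
pose unglue (v : {ffun K1 + K2 -> qT Q}) :=
  ([ffun i => v (inl i)] : {ffun K1 -> qT Q}, [ffun i => v (inr i)] : {ffun K2 -> qT Q}).
have glueK : cancel glue unglue.
  by move=> [v w]; congr pair; apply/ffunP => i; rewrite !ffunE.
have unglueK : cancel unglue glue.
  by move=> v; apply/ffunP => -[] i; rewrite !ffunE.
rewrite {1}/qexp (reindex glue); last exact/onW_bij/(Bijective glueK unglueK).
transitivity (\sum_(p : {ffun K1 -> qT Q} * {ffun K2 -> qT Q})
    ((\prod_i qweight (p.1 i)) * f (fun i => qval (p.1 i))) * \prod_i qweight (p.2 i)).
  apply: eq_bigr => -[v w] _ /=; rewrite big_sumType/=.
  rewrite (eq_bigr (fun i => qweight (v i))); last by move=> i _; rewrite ffunE.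
  rewrite [X in _ * X * _](eq_bigr (fun i => qweight (w i))); last first.
    by move=> i _; rewrite ffunE.
  rewrite mulrAC; congr (_ * f _ * _).
  by apply/funext => i; rewrite ffunE.
rewrite -(pair_big xpredT xpredT (fun (v : {ffun K1 -> qT Q}) (w : {ffun K2 -> qT Q}) =>
  ((\prod_i qweight (v i)) * f (fun i => qval (v i))) * \prod_i qweight (w i)))/=.
apply: eq_bigr => v _; rewrite -mulr_sumr.
by have := qexp_cst K2 1; rewrite /qexp -mulr_suml mulr1 => ->; rewrite mulr1.
Qed.

End quantized_expectation.

(** * The Sudakov-Fernique comparison for rounded Gaussian variables *)

Section interpolation.
Context {R : realType} (Q : quantizer (R := R)) {K T : finType}.
Variables (t0 : T) (b G : R) (a : T -> K -> R) (side : pred K).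
Hypotheses (b0 : 0 < b) (aG : forall t k, `|a t k| <= G).
Hypothesis increments : forall t s,
  \sum_(k | side k) (a t k - a s k) ^+ 2 <= \sum_(k | ~~ side k) (a t k - a s k) ^+ 2.

(** Trigonometric path from the family indexed by [side], at [th = 0], to the complementary one, at
    [th = pi / 2]; [damp] is its velocity. *)
Let amp (k : K) (th : R) : R := if side k then cos th else sin th.
Let damp (k : K) (th : R) : R := if side k then - sin th else cos th.
Let process (x : K -> R) (th : R) (t : T) : R := \sum_k amp k th * x k * a t k.
Let avg : (T -> R) -> (T -> R) -> R := softavg b.
Let var (k : K) (z : T -> R) :=
  avg (fun t => a t k ^+ 2) z - avg (fun t => a t k) z ^+ 2.

Lemma softavg_sum I (s : seq I) P (f : I -> T -> R) z :
  avg (fun t => \sum_(i <- s | P i) f i t) z = \sum_(i <- s | P i) avg (f i) z.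
Proof.
rewrite /avg /softavg -mulr_suml; congr (_ / _).
rewrite /expsum exchange_big; by apply: eq_bigr => t _; rewrite mulr_suml.
Qed.

(** For two independent Gibbs draws the mean squared difference is twice the variance. Hypothesis
    [increments] thus becomes a comparison of summed variances. *)
Let pair_var z (P : pred K) :
  avg (fun t => avg (fun s => \sum_(k | P k) (a t k - a s k) ^+ 2) z) z =
  2 * \sum_(k | P k) var k z.
Proof.
transitivity (avg (fun t => \sum_(k | P k)
    (avg (fun s => a s k ^+ 2) z +
     (-2 * avg (fun s => a s k) z * a t k + a t k ^+ 2))) z).
  congr (avg _ z); apply/funext => t; rewrite softavg_sum; apply: eq_bigr => k _.
  rewrite (_ : (fun s => _) = (fun s => a s k ^+ 2 + (-2 * a t k * a s k + a t k ^+ 2))).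
    rewrite /avg !softavgD softavgZ (softavg_cst b t0); ring.
  by apply/funext => s; ring.
rewrite softavg_sum mulr_sumr; apply: eq_bigr => k _.
by rewrite /avg !softavgD (softavg_cst b t0) softavgZ /var /avg; ring.
Qed.

Let var_le z : \sum_(k | side k) var k z <= \sum_(k | ~~ side k) var k z.
Proof.
rewrite -(ler_pM2l (ltr0Sn R 1)) -!pair_var.
by apply: (le_softavg b t0) => t; apply: (le_softavg b t0) => s; exact: increments.
Qed.

(** Common bound for the functions [h] and [h'] inside [stein]: they are at most [G] and [2 b G^2]
    in modulus, with Lipschitz constants [4 b G^2] and [12 b^2 G^3]. *)
Let C := G + 4 * b * G ^+ 2 + 12 * b ^+ 2 * G ^+ 3.

Let amp_le1 k th : `|amp k th| <= 1.
Proof.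
by rewrite /amp; case: ifP => _; rewrite ler_norml ?cos_geN1 ?cos_le1 ?sin_geN1 ?sin_le1.
Qed.

Let damp_le1 k th : `|damp k th| <= 1.
Proof.
by rewrite /damp; case: ifP => _; rewrite ?normrN ler_norml ?cos_geN1 ?cos_le1 ?sin_geN1 ?sin_le1.
Qed.

Let process_update x k th t y : process (update x k y) th t =
  \sum_(j | j != k) amp j th * x j * a t j + amp k th * a t k * y.
Proof.
rewrite /process (bigD1 k)//= addrC (_ : update x k y k = y); last by rewrite /update eqxx.
congr (_ + _); last by ring.
by apply: eq_bigr => j /negbTE jk; rewrite /update jk.
Qed.

(** With the other coordinates frozen by [qexp_fubini], the Gibbs average of [a^~ k] has derivative
    [b * amp k th] times the Gibbs variance in the coordinate [x k], and [quantizer_stein]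
    applies. *)
Let stein (k : K) (th : R) :
  `|qexp Q (fun x => x k * avg (a^~ k) (process x th)) -
    qexp Q (fun x => b * amp k th * var k (process x th))| <= 2 * C * qerror Q.
Proof.
have b0' := ltW b0.
have G0 : 0 <= G by exact: le_trans (aG t0 k).
have G2 : 0 <= b * G ^+ 2 by rewrite mulr_ge0// exprn_ge0.
have G3 : 0 <= b ^+ 2 * G ^+ 3 by rewrite mulr_ge0// exprn_ge0.
have a2G t : `|a t k ^+ 2| <= G ^+ 2 by rewrite normrX lerXn2r ?nnegrE.
have avg1 z : `|avg (a^~ k) z| <= G by exact: softavg_norm_le.
have varG z : `|var k z| <= 2 * G ^+ 2.
  rewrite (le_trans (ler_normB _ _))// (_ : 2 * G ^+ 2 = G ^+ 2 + G ^+ 2); last by ring.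
  by apply: lerD; [exact: softavg_norm_le|rewrite normrX lerXn2r ?nnegrE].
rewrite (qexp_fubini Q k) [X in _ - X](qexp_fubini Q k) -qexpB.
apply: qexp_norm_le => x.
pose h y := avg (a^~ k) (process (update x k y) th).
pose h' y := b * amp k th * var k (process (update x k y) th).
rewrite (eq_bigr (fun v => qweight v * (qval v * h (@qval _ Q v)))); last first.
  by move=> v _; rewrite {1}/update eqxx.
have dist y y' t : `|process (update x k y) th t - process (update x k y') th t| <= G * `|y - y'|.
  rewrite !process_update opprD addrACA subrr add0r -mulrBr !normrM.
  by rewrite ler_wpM2r// -[leRHS]mul1r ler_pM.
have hL y y' : `|h y - h y'| <= 4 * b * (G * `|y - y'|) * G.
  exact: (softavg_lipschitz t0 b0').
have vL y y' : `|var k (process (update x k y) th) - var k (process (update x k y') th)| <=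
    12 * b * G ^+ 3 * `|y - y'|.
  rewrite /var; set z := process _ _; set z' := process _ _.
  have e1 := softavg_lipschitz t0 b0' a2G (dist y y'); rewrite -/z -/z' in e1.
  have e2 := hL y y'; rewrite /h -/z -/z' in e2.
  rewrite (_ : _ - _ = (avg (fun t => a t k ^+ 2) z - avg (fun t => a t k ^+ 2) z') +
    - ((avg (a^~ k) z + avg (a^~ k) z') * (avg (a^~ k) z - avg (a^~ k) z'))); last by ring.
  rewrite (le_trans (ler_normD _ _))// normrN normrM.
  have e3 : `|avg (a^~ k) z + avg (a^~ k) z'| <= 2 * G.
    by rewrite (le_trans (ler_normD _ _))// mulr_natl mulr2n lerD.
  have := ler_pM (normr_ge0 _) (normr_ge0 _) e3 e2.
  by move/(lerD e1)/le_trans; apply; rewrite le_eqVlt; apply/orP; left; apply/eqP; ring.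
apply: (@quantizer_stein _ Q h h' C).
- move=> y; have zd t : is_derive y (1 : R) (fun y => process (update x k y) th t) (amp k th * a t k).
    rewrite (_ : (fun y => _) = (fun y =>
      \sum_(j | j != k) amp j th * x j * a t j + amp k th * a t k * y)).
      by apply: is_derive_eq; rewrite /GRing.scale/=; ring.
    by apply/funext => {}y; exact: process_update.
  have := @is_derive_softavg R T b t0 (fun y => process (update x k y) th) (fun t => amp k th * a t k) y zd (a^~ k) => dd.
  apply: (is_derive_eq dd).
  rewrite /h' /var /avg softavgZ (_ : (fun t => _ * _) = (fun t => amp k th * a t k ^+ 2)).
    by rewrite softavgZ; ring.
  by apply/funext => t; ring.
- move=> y; rewrite (le_trans (avg1 _))// /C; lra.
- move=> y; rewrite /h' !normrM (gtr0_norm b0).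
  rewrite (@le_trans _ _ (b * 1 * (2 * G ^+ 2)))//.
    by rewrite ler_pM ?mulr_ge0// ler_wpM2l.
  by rewrite /C; lra.
- move=> y y'; rewrite (le_trans (hL y y'))//.
  have -> : 4 * b * (G * `|y - y'|) * G = 4 * b * G ^+ 2 * `|y - y'| by ring.
  by rewrite ler_wpM2r// /C; lra.
- move=> y y'; rewrite -mulrBr !normrM (gtr0_norm b0).
  rewrite (@le_trans _ _ (b * 1 * (12 * b * G ^+ 3 * `|y - y'|)))//.
    by rewrite ler_pM ?mulr_ge0// ler_wpM2l.
  have -> : b * 1 * (12 * b * G ^+ 3 * `|y - y'|) = 12 * b ^+ 2 * G ^+ 3 * `|y - y'| by ring.
  by rewrite ler_wpM2r// /C; lra.
Qed.

Let dPhi th := qexp Q (fun x => avg (fun t => \sum_k damp k th * x k * a t k) (process x th)).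

Let is_derive_Phi th :
  is_derive th (1 : R) (fun th => qexp Q (fun x => logsumexp b (process x th))) (dPhi th).
Proof.
apply: is_derive_bigsum => v.
apply: is_deriveZ.
apply: is_derive_logsumexp => // t.
apply: is_derive_bigsum => k; rewrite /amp /damp.
by case: ifP => _; apply: is_derive_eq; rewrite /GRing.scale/=; ring.
Qed.

(** After Stein's identity the product [damp * amp] is [- sin * cos] on [side] and [sin * cos] off
    it; [var_le] makes the main term nonnegative, and only rounding errors remain. *)
Let dPhi_ge th : 0 <= sin th -> 0 <= cos th -> - (2 * #|K|%:R * C * qerror Q) <= dPhi th.
Proof.
move=> s0 c0.
have -> : dPhi th = \sum_k damp k th * qexp Q (fun x => x k * avg (a^~ k) (process x th)).
  rewrite /dPhi -(eq_bigr _ (fun k _ => qexpZ _ _ _)) -qexp_sum.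
  congr qexp; apply/funext => x; rewrite softavg_sum; apply: eq_bigr => k _.
  by rewrite /avg softavgZ mulrA.
have main : 0 <= \sum_k damp k th * qexp Q (fun x => b * amp k th * var k (process x th)).
  rewrite -(eq_bigr _ (fun k _ => qexpZ _ _ _)) -qexp_sum.
  rewrite -[leLHS](qexp_cst Q K 0); apply: le_qexp => x.
  rewrite (bigID side)/=.
  rewrite (eq_bigr (fun k => - (b * sin th * cos th) * var k (process x th))); last first.
    by move=> k ks; rewrite /damp /amp ks; ring.
  rewrite [X in _ + X](eq_bigr (fun k => (b * sin th * cos th) * var k (process x th))); last first.
    by move=> k /negbTE ks; rewrite /damp /amp ks; ring.
  by rewrite -!mulr_sumr mulNr addrC subr_ge0 ler_wpM2l// !mulr_ge0// ltW.
have err : - (2 * #|K|%:R * C * qerror Q) <=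
   \sum_k damp k th * (qexp Q (fun x => x k * avg (a^~ k) (process x th)) -
      qexp Q (fun x => b * amp k th * var k (process x th))).
  have -> : 2 * #|K|%:R * C * qerror Q = \sum_(k : K) 2 * C * qerror Q.
    by rewrite sumr_const -mulr_natr; ring.
  rewrite -sumrN; apply: ler_sum => k _; rewrite lerNl -mulrN.
  rewrite (le_trans (ler_norm _))// normrM normrN -[leRHS]mul1r.
  by rewrite ler_pM.
rewrite -[leLHS]addr0 (le_trans (lerD err main))// -big_split/=.
by rewrite le_eqVlt; apply/orP; left; apply/eqP; apply: eq_bigr => k _; ring.
Qed.

Lemma quantized_comparison :
  qexp Q (fun x => logsumexp b (fun t => \sum_(k | side k) x k * a t k)) <=
  qexp Q (fun x => logsumexp b (fun t => \sum_(k | ~~ side k) x k * a t k)) +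
  4 * #|K|%:R * C * qerror Q.
Proof.
pose Phi th := qexp Q (fun x => logsumexp b (process x th)).
have E0 : qexp Q (fun x => logsumexp b (fun t => \sum_(k | side k) x k * a t k)) = Phi 0.
  congr qexp; apply/funext => x; congr logsumexp; apply/funext => t.
  rewrite /process big_mkcond; apply: eq_bigr => k _; rewrite /amp cos0 sin0.
  by case: (side k); ring.
have E1 : qexp Q (fun x => logsumexp b (fun t => \sum_(k | ~~ side k) x k * a t k)) = Phi (pi / 2).
  congr qexp; apply/funext => x; congr logsumexp; apply/funext => t.
  rewrite /process big_mkcond; apply: eq_bigr => k _; rewrite /amp cos_pihalf sin_pihalf.
  by case: (side k) => /=; ring.
have /andP[pi0 pi2] := pihalf_02 R.
rewrite E0 E1.
have cPhi : continuous Phi.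
  by move=> th; apply/differentiable_continuous/derivable1_diffP; have := is_derive_Phi th => d.
(* The mean value theorem replaces integration in [th]; the length [pi / 2 <= 2] of the segment
   turns the constant 2 of [dPhi_ge] into 4. *)
have [c] := @MVT_segment R Phi dPhi 0 (pi / 2) (ltW pi0) (fun x _ => is_derive_Phi x)
  (continuous_subspaceT cPhi).
rewrite in_itv/= subr0 => /andP[c0 c1] E.
have s0 : 0 <= sin c by rewrite sin_ge0_pi// c0/= (le_trans c1)// ler_pdivrMr// ler_peMr ?pi_ge0// ler1n.
have co0 : 0 <= cos c by rewrite cos_ge0_pihalf// c1 andbT (le_trans _ c0)// lerNl oppr0 ltW.
have := dPhi_ge s0 co0; set e := 2 * _ * C * qerror Q.
have e0 : 0 <= e.
  (* The bound [aG] yields [0 <= G] only through an element of [K]; for empty [K] the error term is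
     0. *)
  have G0 : 0 <= G \/ #|K| = 0%N.
    case: (pickP (mem K)) => [k _|K0]; last by right; apply/eq_card0.
    by left; exact: le_trans (aG t0 k).
  case: G0 => [G0|K0]; last by rewrite /e K0 mulr0 !mul0r.
  rewrite /e !mulr_ge0 ?qerror_ge0// /C !addr_ge0// !mulr_ge0// ?exprn_ge0 ?sqr_ge0// ltW//.
move=> h; have := ler_wpM2r (ltW pi0) h; rewrite -E.
have := ler_wpM2l e0 (ltW pi2).
have -> : 4 * #|K|%:R * C * qerror Q = e * 2 by rewrite /e; ring.
by lra.
Qed.

End interpolation.

(** * Gaussian families *)

(* Spares us a proof that singular values are measurable functions. *)
Lemma ge0_integral_mono (d : measure_display) (T : measurableType d) (R : realType)
    (mu : {measure set T -> \bar R}) (f g : T -> \bar R) :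
  (forall x, 0 <= f x)%E -> (forall x, f x <= g x)%E ->
  (\int[mu]_x f x <= \int[mu]_x g x)%E.
Proof.
move=> f0 fg; have g0 x : (0 <= g x)%E by exact: le_trans (fg x).
rewrite !ge0_integralTE//; apply: le_ereal_sup => _ [h hf <-].
by exists h => // x; exact: le_trans (fg x).
Qed.

Section gaussian_family.
Context {R : realType} {disp : measure_display} {Omega : measurableType disp}.
Variables (P : probability Omega R) (I : finType) (A : I -> {RV P >-> R}).
Hypothesis A_indep : mutually_independent A.
Hypothesis A_normal : forall i, standard_normal (A i).
Variable Q : quantizer (R := R).

Let code (w : Omega) : {ffun I -> qT Q} := [ffun i => qcell Q (A i w)].

Let codeE v : code @^-1` [set v] =
  \bigcap_(i in [set` [set: I]%SET]) (A i @^-1` (qcell Q @^-1` [set v i])).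
Proof.
apply/seteqP; split => w /=.
  by move=> <- i _ /=; rewrite ffunE.
by move=> h; apply/ffunP => i; rewrite ffunE; apply: h => /=; rewrite inE.
Qed.

Let measurable_cell i v : measurable (A i @^-1` (qcell Q @^-1` [set v])).
Proof.
rewrite -[X in measurable X]setTI; apply: (measurable_funPT (A i)) => //.
exact: measurable_qcell.
Qed.

Let measurable_code v : measurable (code @^-1` [set v]).
Proof.
by rewrite codeE; apply: fin_bigcap_measurable => // i _; exact: measurable_cell.
Qed.

(** Independence over the full index set factorises the probability of a code, and normality of each
    entry identifies the factors with cell weights. *)
Let law_code v : fine (P (code @^-1` [set v])) = \prod_i qweight (v i).
Proof.
rewrite codeE (A_indep [set: I]%SET (fun i => measurable_qcell (v i))).
rewrite (eq_bigr (fun i => (qweight (v i))%:E)).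
  by rewrite prodEFin; apply: eq_bigl => i; rewrite finset.in_setT.
move=> i _; rewrite /qweight fineK; last by apply: fin_num_measure; exact: measurable_qcell.
by rewrite -(A_normal i (measurable_qcell (v i))).
Qed.

Lemma integral_quantized (f : (I -> R) -> R) :
  (\int[P]_w (f (fun i => quant Q (A i w)))%:E = (qexp Q f)%:E)%E.
Proof.
rewrite (eq_integral (fun w => (f (fun i => qval (code w i)))%:E)); last first.
  by move=> w _; congr (EFin (f _)); apply/funext => i; rewrite /code ffunE.
rewrite (integral_finite_range P measurable_code (fun v => f (fun i => qval (v i)))).
by congr EFin; apply: eq_bigr => v _; rewrite law_code.
Qed.

Lemma measurable_integrand_quantized (f : (I -> R) -> R) :
  measurable_fun setT (fun w => f (fun i => quant Q (A i w))).
Proof.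
rewrite (_ : (fun w => _) = (fun w => f (fun i => qval (code w i)))).
  exact: (measurable_finite_range measurable_code (fun v => f (fun i => qval (v i)))).
by apply/funext => w; congr f; apply/funext => i; rewrite ffunE.
Qed.

Lemma measurable_quant_error i :
  measurable_fun setT (fun w => `|A i w - quant Q (A i w)|).
Proof.
apply: measurableT_comp => //; apply: measurable_funB; first exact: measurable_funPT.
exact: (measurableT_comp (measurable_quant Q id) (measurable_funPT (A i))).
Qed.

Lemma integral_quant_error i :
  (\int[P]_w (`|A i w - quant Q (A i w)|)%:E <= (qerror Q)%:E)%E.
Proof.
have mq : measurable_fun setT
    ((fun y => (`|y - quant Q y|)%:E) : measurableTypeR R -> \bar R).
  apply/measurable_EFinP; apply: measurableT_comp => //.
  by apply: measurable_funB => //; exact: (measurable_quant Q id).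
have mX : measurable_fun setT (A i : Omega -> measurableTypeR R).
  exact: (measurable_funPT (A i)).
pose X : {mfun Omega >-> measurableTypeR R} :=
  HB.pack (A i : Omega -> measurableTypeR R) (isMeasurableFun.Build _ _ _ _ _ mX).
have <- := @ge0_integral_distribution _ _ _ _ _ P X _ mq (fun y => normr_ge0 _).
have -> : (\int[distribution P X]_y (`|y - quant Q y|)%:E =
    \int[@normal_prob R 0 1]_y (`|y - quant Q y|)%:E)%E.
  by apply: eq_measure_integral => B mB _; exact: A_normal.
rewrite /qerror /Rintegral fineK; last first.
  exact: (integrable_fin_num measurableT (integrable_qerror Q)).
apply: ge0_integral_mono => y; first by rewrite lee_fin.
by rewrite lee_fin ler_peMl// lerDl.
Qed.

End gaussian_family.

(** * From Gaussian entries to rounded ones, in expectation *)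

Section expectation_bound.
Context {R : realType} {disp : measure_display} {Omega : measurableType disp}.
Variables (P : probability Omega R) (I : finType) (A : I -> {RV P >-> R}).
Hypothesis A_indep : mutually_independent A.
Hypothesis A_normal : forall i, standard_normal (A i).
Variables Q0 Q : quantizer (R := R).

(** The rounding error of each entry integrates to at most [qerror]. The coarse quantizer [Q0] is
    counted twice because a tensor is moved to its coarse rounding and back. *)
Lemma le_expectation_quantized (Z : Omega -> R) (f : (I -> R) -> R) :
  (forall w, 0 <= Z w) -> (forall x, 0 <= f x) ->
  (forall w, Z w <= f (fun i => quant Q (A i w)) +
     (\sum_i `|A i w - quant Q (A i w)| + 2 * \sum_i `|A i w - quant Q0 (A i w)|)) ->
  ('E_P[Z] <= (qexp Q f + (#|I|%:R * qerror Q + 2 * (#|I|%:R * qerror Q0)))%:E)%E.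
Proof.
move=> Z0 f0 Zf; rewrite unlock.
have mS q : measurable_fun setT (fun w => \sum_i `|A i w - quant q (A i w)|).
  by apply: measurable_sum => i; exact: measurable_quant_error.
have S0 q w : 0 <= \sum_i `|A i w - quant q (A i w)| by exact: sumr_ge0.
have Sle q : (\int[P]_w (\sum_i `|A i w - quant q (A i w)|)%:E <= (#|I|%:R * qerror q)%:E)%E.
  under eq_integral do rewrite -sumEFin.
  rewrite ge0_integral_sum//; last by move=> i; apply/measurable_EFinP; exact: measurable_quant_error.
  rewrite mulr_natl -sumr_const -sumEFin.
  by apply: lee_sum => i _; exact: integral_quant_error.
apply: (@le_trans _ _ (\int[P]_w ((f (fun i => quant Q (A i w)))%:E +
    ((\sum_i `|A i w - quant Q (A i w)|)%:E + 2%:E * (\sum_i `|A i w - quant Q0 (A i w)|)%:E)))%E).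
  by apply: ge0_integral_mono => w; rewrite ?lee_fin// -EFinM -!EFinD lee_fin.
rewrite ge0_integralD//; last 4 first.
- by move=> w _; rewrite lee_fin.
- by apply/measurable_EFinP; exact: measurable_integrand_quantized.
- by move=> w _; rewrite -EFinM -EFinD lee_fin addr_ge0// mulr_ge0.
- apply: emeasurable_funD; first exact/measurable_EFinP.
  by apply: measurable_funeM; apply/measurable_EFinP.
rewrite ge0_integralD//; last 4 first.
- by move=> w _; rewrite lee_fin.
- exact/measurable_EFinP.
- by move=> w _; rewrite -EFinM lee_fin mulr_ge0.
- by apply: measurable_funeM; apply/measurable_EFinP.
rewrite ge0_integralZl//; last 2 first.
- exact/measurable_EFinP.
- by move=> w _; rewrite lee_fin.
rewrite integral_quantized// [leRHS]EFinD leeD2l// [leRHS]EFinD leeD//.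
by rewrite [leRHS]EFinM lee_wpmul2l.
Qed.

End expectation_bound.

(** * Tensors on products of spheres *)

(** Integrate [y ^+ 2 <= M * powR |y| (2 * s + 1) + y ^+ 4 / M]: the left side gives 1, and the
    choice of [M] keeps the quartic term below 1. *)
Lemma std_normal_abs_moment_gt0 (R : realType) (s : R) : 0 <= s <= 1 / 2 ->
  0 < \int[@normal_prob R 0 1]_x (`|x| `^ (2 * s + 1)).
Proof.
move=> s01.
pose g := @normal_prob R 0 1.
have i4 : g.-integrable setT (EFin \o (fun x : R => x ^+ 4)).
  apply: (std_normal_integrable (C := 1)); first exact: measurable_funX.
  by move=> y; rewrite mul1r ger0_norm ?exprn_even_ge0// lerDr.
have iq := std_normal_abs_integrable s01.
pose F := \int[g]_x (x ^+ 4 : R).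
have F0 : 0 <= F by apply: Rintegral_ge0 => x _; rewrite exprn_even_ge0.
pose M := 1 + 2 * F.
have M1 : 1 <= M by rewrite lerDl mulr_ge0.
have M0 : 0 < M by exact: lt_le_trans M1.
have i2 : g.-integrable setT (EFin \o (fun x : R => x ^+ 2)).
  apply: (std_normal_integrable (C := 1)); first exact: measurable_funX.
  move=> y; rewrite ger0_norm ?sqr_ge0// (_ : y ^+ 4 = y ^+ 2 ^+ 2); last by rewrite -exprM.
  by have := sqr_ge0 (y ^+ 2 - 1); have := sqr_ge0 y; nra.
(* Three regimes: the quartic term dominates when [M <= |y| ^+ 2]; for [|y| <= 1] the inequality
   [2 * s + 1 <= 2] of exponents suffices; in between the power is at least 1 and [M] exceeds
   [y ^+ 2]. *)
have pt (y : R) : y ^+ 2 <= M * `|y| `^ (2 * s + 1) + M^-1 * y ^+ 4.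
  have q1 : 1 <= 2 * s + 1 by move: s01 => /andP[? ?]; lra.
  have q2 : 2 * s + 1 <= 2 by move: s01 => /andP[? ?]; lra.
  have y4 : y ^+ 4 = `|y| ^+ 2 * `|y| ^+ 2.
    by rewrite real_normK ?num_real// -exprD.
  have y2 : y ^+ 2 = `|y| ^+ 2 by rewrite real_normK ?num_real.
  have y40 : 0 <= M^-1 * y ^+ 4 by rewrite mulr_ge0 ?invr_ge0 ?exprn_even_ge0// ltW.
  have [My|yM] := leP M (`|y| ^+ 2).
    rewrite (le_trans (y := M^-1 * y ^+ 4))//.
      by rewrite y4 y2 ler_pdivlMl// ler_wpM2r// exprn_ge0.
    by rewrite lerDr mulr_ge0 ?powR_ge0// ltW.
  rewrite (le_trans (y := M * `|y| `^ (2 * s + 1)))//; last by rewrite lerDl.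
  rewrite y2; have [y1|y1] := leP `|y| 1.
    have [->|y0] := eqVneq `|y| 0.
      by rewrite expr0n/= mulr_ge0 ?powR_ge0// ltW.
    rewrite (@le_trans _ _ (`|y| `^ (2 * s + 1)))//.
      by rewrite -powR_mulrn// ger_powR// y1 andbT lt_neqAle eq_sym y0/=.
    by rewrite ler_peMl// powR_ge0.
  have q0 : 1 <= `|y| `^ (2 * s + 1).
    rewrite -[leLHS](powRr0 `|y|); apply: ler_powR; first exact: ltW.
    by rewrite (le_trans _ q1).
  rewrite (le_trans (ltW yM))//; have := ler_wpM2l (ltW M0) q0.
  by rewrite mulr1.
have : 1 <= M * \int[g]_x (`|x| `^ (2 * s + 1)) + M^-1 * F.
  have j1 := integrableZl measurableT M iq; have j2 := integrableZl measurableT M^-1 i4.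
  rewrite -(RintegralZl M measurableT iq) -(RintegralZl M^-1 measurableT i4).
  rewrite -(RintegralD measurableT j1 j2) -[leLHS](@std_normal_sqr_integral R).
  apply: le_Rintegral => //; first exact: (integrableD measurableT j1 j2).
have : M^-1 * F < 1 by rewrite mulrC ltr_pdivrMr// mul1r /M; lra.
by move=> h1 h2; rewrite -(pmulr_rgt0 _ M0) -(ltrD2r (M^-1 * F)) add0r (lt_le_trans h1 h2).
Qed.

Section sphere.
Context {R : realType} {d : nat} {n : 'I_d -> nat}.
Variable p : nat.
Hypothesis p0 : (0 < p)%N.

Definition lp_sphere (u : vectors R n) : Prop :=
  forall j, \sum_(i < n j) `|u j 0 i| ^+ p = 1.

Lemma lp_sphere_le1 u : lp_sphere u -> forall j i, `|u j 0 i| <= 1.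
Proof.
move=> u1 j i; rewrite leNgt; apply/negP => h.
suff : 1 < \sum_(i < n j) `|u j 0 i| ^+ p by rewrite u1 ltxx.
rewrite (bigD1 i)//= ltr_wpDr//; last by rewrite exprn_egt1// -lt0n.
by apply: sumr_ge0 => k _; rewrite exprn_ge0.
Qed.

Lemma lp_sphere_prod_le1 u : lp_sphere u ->
  forall i : multi_index n, `|\prod_j u j 0 (i j)| <= 1.
Proof.
move=> u1 i; rewrite normr_prod; apply: prodr_ile1 => j _.
by rewrite normr_ge0 lp_sphere_le1.
Qed.

(** The entries of the rank-one tensor are at most 1 in modulus, so pairing with it is 1-Lipschitz
    for the l^1 norm. *)
Lemma tensor_inner_dist (x y : tensor R n) u : lp_sphere u ->
  tensor_inner x u <= tensor_inner y u + \sum_i `|x i - y i|.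
Proof.
move=> u1; rewrite -lerBlDl -sumrB; apply: ler_sum => i _.
rewrite -mulrBl (le_trans (ler_norm _))// normrM ler_piMr//.
exact: lp_sphere_prod_le1.
Qed.

(** Negating one factor negates the rank-one tensor and stays on the spheres; this symmetry makes
    the maxima nonnegative. *)
Definition flip (j0 : 'I_d) (u : vectors R n) : vectors R n :=
  fun j => if j == j0 then - u j else u j.

Lemma lp_sphere_flip j0 u : lp_sphere u -> lp_sphere (flip j0 u).
Proof.
move=> u1 j; rewrite -[RHS](u1 j) /flip; case: eqP => // _.
by apply: eq_bigr => i _; rewrite mxE normrN.
Qed.

Lemma prod_flip j0 u (i : multi_index n) :
  \prod_j flip j0 u j 0 (i j) = - \prod_j u j 0 (i j).
Proof.
rewrite (bigD1 j0)//= [in RHS](bigD1 j0)//= /flip eqxx mxE mulNr.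
by congr (- (_ * _)); apply: eq_bigr => j /negbTE ->.
Qed.

Lemma tensor_inner_flip j0 (x : tensor R n) u :
  tensor_inner x (flip j0 u) = - tensor_inner x u.
Proof.
rewrite /tensor_inner -sumrN; apply: eq_bigr => i _.
by rewrite prod_flip mulrN.
Qed.

End sphere.

Lemma young_scaled (R : realType) (p q r x u : R) :
  0 < p -> 0 < q -> p^-1 + q^-1 = 1 -> 0 < r ->
  x * u <= r `^ q / q * `|x| `^ q + r `^ (- p) / p * `|u| `^ p.
Proof.
move=> p0 q0 pq r0; rewrite (le_trans (ler_norm _))// normrM.
have r0' := ltW r0.
have a0 : 0 <= r * `|x| by rewrite mulr_ge0.
have b0 : 0 <= `|u| / r by rewrite divr_ge0.
have qp : q^-1 + p^-1 = 1 by rewrite addrC.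
have := conjugate_powR a0 b0 q0 p0 qp.
rewrite !powRM ?invr_ge0// -(powR_inv1 r0') -powRrM mulN1r.
rewrite (powR_inv1 r0') (_ : r * `|x| * (`|u| / r) = `|x| * `|u|); last first.
  by field; rewrite gt_eqF.
by move=> h; rewrite (le_trans h)// le_eqVlt; apply/orP; left; apply/eqP; ring.
Qed.

Lemma sum_tagged (R : realType) (d : nat) (n : 'I_d -> nat)
    (F : forall j, 'I_(n j) -> R) :
  \sum_(e : {j : 'I_d & 'I_(n j)}) F (tag e) (tagged e) = \sum_j \sum_i F j i.
Proof. by rewrite (sig_big_dep _ (fun j => xpredT)). Qed.

(** * The expectation bound for a general exponent [p] and coefficients [lam] *)

Section gaussian_tensor.
Context {R : realType} {disp : measure_display} {Omega : measurableType disp}.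
Variables (P : probability Omega R) (d : nat) (n : 'I_d -> nat).
Variable A : multi_index n -> {RV P >-> R}.
Hypothesis n_ge1 : forall j, (1 <= n j)%N.
Hypothesis A_indep : mutually_independent A.
Hypothesis A_normal : forall i, standard_normal (A i).
Variables (p : nat) (j0 : 'I_d) (sv : tensor R n -> R) (lam : 'I_d -> R).
Hypothesis p2 : (2 <= p)%N.
Hypothesis lam0 : forall j, 0 <= lam j.
Hypothesis sv_max : forall B, exists2 u, lp_sphere p u &
  tensor_inner B u = sv B /\
  forall v, lp_sphere p v -> tensor_inner B v <= sv B.
Hypothesis increments : forall u v : vectors R n, lp_sphere p u -> lp_sphere p v ->
  \sum_(i : multi_index n) (\prod_j u j 0 (i j) - \prod_j v j 0 (i j)) ^+ 2 <=
  \sum_j \sum_(i < n j) (lam j * u j 0 i - lam j * v j 0 i) ^+ 2.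

(** [q = 2 * s + 1] is the exponent conjugate to [p], written in the form of the moment lemmas. *)
Let s : R := 1 / (2 * (p%:R - 1)).
Let q : R := 2 * s + 1.
Let moment : R := \int[@normal_prob R 0 1]_x (`|x| `^ q).
Let N j : R := (n j)%:R * moment.
(** The scale that balances the two terms of Young's inequality in expectation: [r ^ q * N] and
    [r ^ (- p)] both equal [N ^ (1 / q)], by [rq] and [rN]. *)
Let r j : R := N j `^ (- (p%:R * q)^-1).
Let edge : finType := {j : 'I_d & 'I_(n j)}.

Let p1 : 1 <= p%:R - 1 :> R.
Proof. by rewrite lerBrDr -[1 + 1]/(2%:R) ler_nat. Qed.

Let s01 : 0 < s <= 1 / 2.
Proof.
have h : 0 < 2 * (p%:R - 1) :> R by have := p1; lra.
rewrite /s divr_gt0//= ler_pdivrMr//; have := p1; lra.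
Qed.

Let pR0 : 0 < p%:R :> R. Proof. by rewrite ltr0n (leq_trans _ p2). Qed.

Let qE : q = p%:R / (p%:R - 1).
Proof. by rewrite /q /s; field; rewrite gt_eqF// (lt_le_trans _ p1). Qed.

Let q0 : 0 < q.
Proof. by rewrite qE divr_gt0// (lt_le_trans _ p1). Qed.

Let pq : p%:R^-1 + q^-1 = 1.
Proof. by rewrite qE; field; rewrite !gt_eqF// (lt_le_trans _ p1). Qed.

Let moment0 : 0 < moment.
Proof. by apply: std_normal_abs_moment_gt0; case/andP: s01 => /ltW -> ->. Qed.

Let N0 j : 0 < N j.
Proof. by rewrite mulr_gt0// ltr0n. Qed.

Let r0 j : 0 < r j. Proof. exact: powR_gt0. Qed.

Let rN j : r j `^ (- p%:R) = N j `^ q^-1.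
Proof.
rewrite -powRrM; congr powR; field.
by rewrite !gt_eqF.
Qed.

Let rq j : r j `^ q * N j = N j `^ q^-1.
Proof.
rewrite -powRrM -{2}[N j]powRr1 ?ltW// -powRD; last by apply/implyP => _; rewrite gt_eqF.
congr powR; rewrite -[X in _ + X]pq; field.
by rewrite !gt_eqF.
Qed.

(** Young's inequality termwise; on the spheres the powers of [u] sum to 1 in each factor, so the
    right side is free of [u] and bounds the whole supremum. *)
Let dual u (x : edge -> R) : lp_sphere p u ->
  \sum_e x e * (lam (tag e) * u (tag e) 0 (tagged e)) <=
  \sum_e (lam (tag e) * (r (tag e) `^ q / q)) * `|x e| `^ q +
  \sum_j lam j * (N j `^ q^-1 / p%:R).
Proof.
move=> u1.
have -> : \sum_j lam j * (N j `^ q^-1 / p%:R) =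
    \sum_(e : edge) lam (tag e) * (N (tag e) `^ q^-1 / p%:R * `|u (tag e) 0 (tagged e)| ^+ p).
  rewrite (sum_tagged (fun j i => lam j * (N j `^ q^-1 / p%:R * `|u j 0 i| ^+ p))).
  by apply: eq_bigr => j _; rewrite -!mulr_sumr u1 mulr1.
rewrite -big_split/=; apply: ler_sum => e _.
rewrite mulrCA -[X in _ <= X + _]mulrA -mulrDr ler_wpM2l//.
have := @young_scaled R p%:R q (r (tag e)) (x e) (u (tag e) 0 (tagged e)) pR0 q0 pq (r0 _).
by rewrite rN powR_mulrn.
Qed.

(** Rounding towards zero keeps the rounded moment below [moment]; the two parts then add up with
    weights [1 / q] and [1 / p]. *)
Let qexp_dual (Q : quantizer (R := R)) :
  qexp Q (fun x : multi_index n + edge -> R =>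
    \sum_e (lam (tag e) * (r (tag e) `^ q / q)) * `|x (inr e)| `^ q +
    \sum_j lam j * (N j `^ q^-1 / p%:R)) <= \sum_j lam j * N j `^ q^-1.
Proof.
rewrite qexpD qexp_cst qexp_sum.
have mQ : \sum_a qweight a * `|@qval _ Q a| `^ q <= moment.
  rewrite (qsumE Q (fun y => `|y| `^ q)); apply: le_Rintegral => //.
  - exact: (integrable_quant Q (fun y => `|y| `^ q)).
  - by apply: std_normal_abs_integrable; case/andP: s01 => /ltW -> ->.
  by move=> y _; apply: ge0_ler_powR; rewrite ?nnegrE ?qval_le// ltW.
rewrite (@le_trans _ _ (\sum_(e : edge) lam (tag e) * (r (tag e) `^ q / q) * moment +
    \sum_j lam j * (N j `^ q^-1 / p%:R)))//.
  rewrite lerD2r; apply: ler_sum => e _.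
  rewrite qexpZ (qexp_coord Q (inr e) (fun y => `|y| `^ q)) ler_wpM2l//.
  by rewrite mulr_ge0// divr_ge0 ?powR_ge0 ?ltW.
rewrite (sum_tagged (fun j i => lam j * (r j `^ q / q) * moment)) -big_split/=.
rewrite le_eqVlt; apply/orP; left; apply/eqP; apply: eq_bigr => j _.
rewrite sumr_const card_ord -[_ *+ n j]mulr_natr.
have -> : lam j * (r j `^ q / q) * moment * (n j)%:R = lam j * (r j `^ q * N j / q).
  by rewrite /N; ring.
rewrite rq -mulrDr; congr (_ * _); rewrite -mulrDr addrC pq mulr1//.
Qed.

Let sv_ge0 B : 0 <= sv B.
Proof.
have [u u1 [uE umax]] := sv_max B.
have := umax _ (lp_sphere_flip j0 u1); rewrite tensor_inner_flip uE; lra.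
Qed.

Let best B := s2val (cid2 (sv_max B)).

Let best_sphere B : lp_sphere p (best B).
Proof. exact: s2valP (cid2 (sv_max B)). Qed.

Let bestE B : tensor_inner B (best B) = sv B.
Proof. by have [] := s2valP' (cid2 (sv_max B)). Qed.

Let sv_ub B v : lp_sphere p v -> tensor_inner B v <= sv B.
Proof. by have [_] := s2valP' (cid2 (sv_max B)); apply. Qed.

Let G := 1 + \sum_j lam j.

(** [Q0] fixes the finite set of test points, hence the [ln] term; [Q] serves the comparison and can
    be refined afterwards. *)
Let step (Q0 Q : quantizer (R := R)) (b : R) : 0 < b ->
  ('E_P[fun w => sv (fun i => A i w)] <=
    (\sum_j lam j * N j `^ q^-1
     + ln #|{: {ffun multi_index n -> qT Q0} * bool}|%:R / b
     + 4 * #|{: multi_index n + edge}|%:R *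
         (G + 4 * b * G ^+ 2 + 12 * b ^+ 2 * G ^+ 3) * qerror Q
     + (#|multi_index n|%:R * qerror Q + 2 * (#|multi_index n|%:R * qerror Q0)))%:E)%E.
Proof.
move=> b0.
(* One maximiser for every coarsely rounded tensor, together with its sign flip; the flips make [f]
   nonnegative. *)
pose T : finType := ({ffun multi_index n -> qT Q0} * bool)%type.
pose us (t : T) : vectors R n :=
  if t.2 then best (fun i => qval (t.1 i)) else flip j0 (best (fun i => qval (t.1 i))).
have usP t : lp_sphere p (us t).
  by rewrite /us; case: ifP => _; [|apply: lp_sphere_flip]; exact: best_sphere.
pose a (t : T) (k : multi_index n + edge) : R := match k with
  | inl i => \prod_j us t j 0 (i j)
  | inr e => lam (tag e) * us t (tag e) 0 (tagged e) end.
pose side (k : multi_index n + edge) := if k is inl _ then true else false.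
pose t0 : T := ([ffun=> qcell Q0 0], true).
have aG t k : `|a t k| <= G.
  case: k => [i|e] /=.
    rewrite (le_trans (lp_sphere_prod_le1 (ltnW p2) (usP t) i))//.
    by rewrite lerDl sumr_ge0.
  rewrite normrM ger0_norm// (@le_trans _ _ (lam (tag e)))//.
    by rewrite ler_piMr// (lp_sphere_le1 (ltnW p2)).
  rewrite /G (bigD1 (tag e))//= addrCA lerDl addr_ge0// sumr_ge0//.
have inc t t' : \sum_(k | side k) (a t k - a t' k) ^+ 2 <=
    \sum_(k | ~~ side k) (a t k - a t' k) ^+ 2.
  rewrite !big_sumType/= big_pred0_eq addr0 big_pred0_eq add0r.
  rewrite (sum_tagged (fun j i => (lam j * us t j 0 i - lam j * us t' j 0 i) ^+ 2)).
  exact: increments.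
pose f (x : multi_index n -> R) := logsumexp b (fun t => tensor_inner x (us t)).
have f_ge x t : tensor_inner x (us t) <= f x by exact: (logsumexp_ge _ (fun t => tensor_inner x (us t))).
have f0 x : 0 <= f x.
  have := f_ge x t0; have := f_ge x (t0.1, false).
  rewrite /us/= tensor_inner_flip; lra.
(* Passing from [x] to its coarse rounding costs one [Q0] error, pairing the coarse maximiser with
   [x] again costs another, and replacing [x] by its fine rounding costs one [Q] error. *)
have svf (x : multi_index n -> R) : sv x <= f (fun i => quant Q (x i)) +
    (\sum_i `|x i - quant Q (x i)| + 2 * \sum_i `|x i - quant Q0 (x i)|).
  have u1 := best_sphere x.
  pose v : {ffun multi_index n -> qT Q0} := [ffun i => qcell Q0 (x i)].
  have vE : (fun i => qval (v i)) = (fun i => quant Q0 (x i)).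
    by apply/funext => i; rewrite ffunE.
  have h1 := tensor_inner_dist (ltnW p2) x (fun i => quant Q0 (x i)) u1.
  have h2 := sv_ub (fun i => quant Q0 (x i)) u1.
  have u2 := best_sphere (fun i => quant Q0 (x i)).
  have h3 := tensor_inner_dist (ltnW p2) (fun i => quant Q0 (x i)) x u2.
  have h4 := tensor_inner_dist (ltnW p2) x (fun i => quant Q (x i)) u2.
  have h5 := f_ge (fun i => quant Q (x i)) (v, true).
  rewrite /us/= vE in h5.
  rewrite bestE in h1; rewrite bestE in h3.
  rewrite (eq_bigr (fun i => `|x i - quant Q0 (x i)|)) in h3; last by move=> i _; rewrite distrC.
  rewrite /= in h1 h3 h4.
  move: h1 h2 h3 h4 h5; set S0 := \sum_i `|x i - quant Q0 (x i)|.
  set S := \sum_i `|x i - quant Q (x i)|; set x0 := fun i => quant Q0 (x i).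
  set fq := f _; set y := tensor_inner _ (best x0).
  lra.
apply: (le_trans (le_expectation_quantized A_indep A_normal (Q0 := Q0) (Q := Q)
  (Z := fun w => sv (fun i => A i w)) (f := f) _ _ _)) => //.
rewrite lee_fin lerD2r.
have := @quantized_comparison R Q _ T t0 b G a side b0 aG inc.
have -> : qexp Q (fun x => logsumexp b (fun t => \sum_(k | side k) x k * a t k)) = qexp Q f.
  rewrite -(qexp_inl Q edge f); congr qexp; apply/funext => x.
  congr logsumexp; apply/funext => t.
  by rewrite big_sumType/= big_pred0_eq addr0.
move=> /le_trans; apply; rewrite lerD2r.
rewrite (le_trans _ (lerD (qexp_dual Q) (lexx _)))// -(qexp_cst Q (multi_index n + edge)%type (ln _ / b)) -qexpD.
apply: le_qexp => x; apply: (logsumexp_le t0) => // t.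
rewrite big_sumType/= big_pred0_eq add0r.
exact: (dual (fun e => x (inr e)) (usP t)).
Qed.

Lemma gaussian_tensor_bound :
  ('E_P[fun w => sv (fun i => A i w)] <=
   (\sum_j lam j * ((n j)%:R * \int[@normal_prob R 0 1]_x
     (`|x| `^ (2 * (1 / (2 * (p%:R - 1))) + 1))) `^ ((p%:R - 1) / p%:R))%:E)%E.
Proof.
have -> : (p%:R - 1) / p%:R = q^-1 by rewrite qE invf_div.
apply/lee_addgt0Pr => e e0.
set I := #|multi_index n|%:R : R.
have I0 : 0 <= I by rewrite ler0n.
(* Order of choices: [Q0], which fixes [L]; then the inverse temperature [b], which fixes [D];
   finally [Q]. The three resulting errors are at most [e / 4] each. *)
have [Q0 hQ0] := @exists_quantizer R (e / (8 * (I + 1))) (divr_gt0 e0 (mulr_gt0 (ltr0n _ 8) (ltr_wpDl I0 ltr01))).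
pose L := ln #|{: {ffun multi_index n -> qT Q0} * bool}|%:R : R.
have L0 : 0 <= L.
  by rewrite ln_ge0// ler1n; apply/card_gt0P; exists ([ffun=> qcell Q0 0], true).
pose b := 4 * (L + 1) / e.
have b0 : 0 < b by rewrite divr_gt0// mulr_gt0// ltr_wpDl.
pose D := 4 * #|{: multi_index n + edge}|%:R * (G + 4 * b * G ^+ 2 + 12 * b ^+ 2 * G ^+ 3) + I.
have G0 : 0 <= G by rewrite addr_ge0// sumr_ge0.
have D0 : 0 <= D.
  have b0' := ltW b0.
  have G2 : 0 <= b * G ^+ 2 by rewrite mulr_ge0// exprn_ge0.
  have G3 : 0 <= b ^+ 2 * G ^+ 3 by rewrite mulr_ge0// exprn_ge0.
  by rewrite /D addr_ge0// mulr_ge0//; lra.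
have [Q hQ] := @exists_quantizer R (e / (4 * (D + 1))) (divr_gt0 e0 (mulr_gt0 (ltr0n _ 4) (ltr_wpDl D0 ltr01))).
apply: (le_trans (step Q0 Q b0)); rewrite -EFinD lee_fin.
have e1 : L / b <= e / 4.
  rewrite ler_pdivrMr// /b (_ : e / 4 * _ = L + 1); first by rewrite lerDl.
  by field; rewrite gt_eqF.
have e2 : D * qerror Q <= e / 4.
  rewrite (le_trans (ler_wpM2l D0 hQ))// mulrA ler_pdivrMr ?mulr_gt0 ?ltr_wpDl//.
  rewrite (_ : e / 4 * _ = (D + 1) * e); last by field.
  by rewrite ler_pM2r// lerDl.
have e3 : I * qerror Q0 <= e / 8.
  rewrite (le_trans (ler_wpM2l I0 hQ0))// mulrA ler_pdivrMr ?mulr_gt0 ?ltr_wpDl//.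
  rewrite (_ : e / 8 * _ = (I + 1) * e); last by field.
  by rewrite ler_pM2r// lerDl.
rewrite [leLHS](_ : _ = \sum_j lam j * N j `^ q^-1 +
    (L / b + (D * qerror Q + 2 * (I * qerror Q0)))); last by rewrite /D /L /I; ring.
by apply: lerD; [exact: lexx|lra].
Qed.

End gaussian_tensor.

(** * Distances between rank-one tensors *)

Lemma sum_prod_dffun (R : comPzRingType) (I : finType) (T_ : I -> finType)
    (F : forall i, T_ i -> R) :
  \sum_(f : {dffun forall i, T_ i}) \prod_i F i (f i) = \prod_i \sum_x F i x.
Proof.
rewrite (reindex (@dffun_of_fprod _ T_)); last exact/onW_bij/dffun_of_fprod_bij.
pose P_ i : {ffun T_ i -> R} := [ffun x => F i x].
transitivity (\sum_(t : fprod T_) \prod_(i in I) P_ i (t i)).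
  by apply: eq_bigr => t _; apply: eq_bigr => i _; rewrite /P_ /dffun_of_fprod !ffunE.
rewrite big_fprod -(bigA_distr_big_dep (fun i => tagged_with T_ i) (fun i g => untag 0 (P_ i) g)).
apply: eq_bigr => i _; have := @big_tag R 0 +%R I T_ (fun i => P_ i) i; move=> <-.
by apply: eq_bigr => x _; rewrite ffunE.
Qed.

Lemma sqr_sum_le (R : realDomainType) (d : nat) (x : 'I_d -> R) :
  (\sum_j x j) ^+ 2 <= d%:R * \sum_j x j ^+ 2.
Proof.
rewrite -(ler_pM2l (ltr0Sn R 1)) expr2 big_distrlr/=.
have -> : 2%:R * (d%:R * \sum_j x j ^+ 2) = \sum_j \sum_k (x j ^+ 2 + x k ^+ 2).
  under [RHS]eq_bigr do rewrite big_split/= sumr_const card_ord -[_ *+ d]mulr_natl.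
  by rewrite big_split/= -mulr_sumr sumr_const card_ord -[_ *+ d]mulr_natl; ring.
rewrite mulr_sumr; apply: ler_sum => j _; rewrite mulr_sumr; apply: ler_sum => k _.
by have := sqr_ge0 (x j - x k); lra.
Qed.

(** The inductive step is [(1 - c) * (1 - x) >= 0] with [x] the remaining product, so the bound on
    [|x|] is carried along. *)
Lemma one_sub_prod_le (R : realDomainType) (I : Type) (r : seq I) (c : I -> R) :
  (forall i, `|c i| <= 1) -> 1 - \prod_(i <- r) c i <= \sum_(i <- r) (1 - c i).
Proof.
move=> c1; suff [] : 1 - \prod_(i <- r) c i <= \sum_(i <- r) (1 - c i) /\
  `|\prod_(i <- r) c i| <= 1 by [].
elim: r => [|i r [IH1 IH2]]; first by rewrite !big_nil subrr normr1.
rewrite !big_cons normrM; split; last by rewrite mulr_ile1.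
have := c1 i; move: IH1 IH2; set x := \prod_(j <- r) _; set S := \sum_(j <- r) _.
rewrite !ler_norml => h /andP[_ x1] /andP[_ ci1].
have : 0 <= (1 - c i) * (1 - x) by rewrite mulr_ge0// subr_ge0.
lra.
Qed.

(** Factors [a] are replaced by [b] one at a time, from the first; the [j]-th summand is the effect
    of the [j]-th replacement. *)
Lemma prod_sub_telescope (R : comPzRingType) (d : nat) (a b : 'I_d -> R) :
  \prod_j a j - \prod_j b j =
  \sum_(j < d) \prod_(k < d) (if (k < j)%N then b k else if k == j then a j - b j else a k).
Proof.
pose h m := \prod_(k < d) (if (k < m)%N then b k else a k).
have -> : \prod_j a j = h 0 by apply: eq_bigr.
have -> : \prod_j b j = h d by apply: eq_bigr => k _; rewrite ltn_ord.
have -> : h 0 - h d = \sum_(j < d) (h j - h j.+1).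
  rewrite -opprB -(telescope_sumr h (leq0n d)) big_mkord -sumrN.
  by apply: eq_bigr => j _; rewrite opprB.
apply: eq_bigr => j _; rewrite /h.
rewrite (bigD1 j)//= [X in _ - X](bigD1 j)//= [RHS](bigD1 j)//= !ltnn ltnSn eqxx mulrBl.
congr (_ * _ - _ * _); apply: eq_bigr => k /negbTE kj; rewrite kj//.
by rewrite ltnS leq_eqVlt -[(k == j :> nat)]/(k == j) kj.
Qed.

Section increments.
Context {R : realType} {d : nat} {n : 'I_d -> nat}.
Implicit Types u v : vectors R n.

(** With [c j] the inner products of the unit factors, the squared distances are [2 * (1 - prod c)]
    for the tensors and [2 * (1 - c j)] for the factors; [one_sub_prod_le] compares them without a
    factor [d]. *)
Lemma rank1_sqr_dist_unit u v : lp_sphere 2 u -> lp_sphere 2 v ->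
  \sum_(i : multi_index n) (\prod_j u j 0 (i j) - \prod_j v j 0 (i j)) ^+ 2 <=
  \sum_j \sum_(i < n j) (1 * u j 0 i - 1 * v j 0 i) ^+ 2.
Proof.
move=> u1 v1.
have u1' j : \sum_(i < n j) u j 0 i ^+ 2 = 1.
  by rewrite -[RHS](u1 j); apply: eq_bigr => i _; rewrite real_normK ?num_real.
have v1' j : \sum_(i < n j) v j 0 i ^+ 2 = 1.
  by rewrite -[RHS](v1 j); apply: eq_bigr => i _; rewrite real_normK ?num_real.
pose c j := \sum_(i < n j) u j 0 i * v j 0 i.
have dist j : \sum_(i < n j) (1 * u j 0 i - 1 * v j 0 i) ^+ 2 = 2 * (1 - c j).
  rewrite (eq_bigr (fun i => u j 0 i ^+ 2 + v j 0 i ^+ 2 + (-2) * (u j 0 i * v j 0 i))).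
    by rewrite !big_split/= u1' v1' -mulr_sumr -/(c j); ring.
  by move=> i _; ring.
have c1 j : `|c j| <= 1.
  have h1 : 0 <= 2 * (1 - c j) by rewrite -dist sumr_ge0// => i _; rewrite sqr_ge0.
  have h2 : 0 <= 2 * (1 + c j).
    have -> : 2 * (1 + c j) = \sum_(i < n j) (u j 0 i + v j 0 i) ^+ 2.
      rewrite [RHS](eq_bigr (fun i => u j 0 i ^+ 2 + v j 0 i ^+ 2 + 2 * (u j 0 i * v j 0 i))).
        by rewrite !big_split/= u1' v1' -mulr_sumr -/(c j); ring.
      by move=> i _; ring.
    by rewrite sumr_ge0// => i _; rewrite sqr_ge0.
  by rewrite ler_norml; apply/andP; split; lra.
rewrite (eq_bigr (fun j => 2 * (1 - c j))) => [|j _]; last exact: dist.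
rewrite -mulr_sumr.
have -> : \sum_(i : multi_index n) (\prod_j u j 0 (i j) - \prod_j v j 0 (i j)) ^+ 2 =
    2 * (1 - \prod_j c j).
  rewrite (eq_bigr (fun i : multi_index n => \prod_j (u j 0 (i j) ^+ 2) + \prod_j (v j 0 (i j) ^+ 2) +
     (-2) * \prod_j (u j 0 (i j) * v j 0 (i j)))).
    rewrite !big_split/= -mulr_sumr.
    rewrite (sum_prod_dffun (fun j x => u j 0 x ^+ 2)) (sum_prod_dffun (fun j x => v j 0 x ^+ 2)).
    rewrite (sum_prod_dffun (fun j x => u j 0 x * v j 0 x)).
    have -> : \prod_j \sum_x u j 0 x ^+ 2 = 1 by apply: big1.
    have -> : \prod_j \sum_x v j 0 x ^+ 2 = 1 by apply: big1.
    by rewrite /c; ring.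
  by move=> i _; rewrite !prodrXl big_split/=; ring.
by rewrite ler_pM2l// one_sub_prod_le.
Qed.

(** Telescoping gives [d] rank-one tensors, each with a difference in a single factor;
    Cauchy-Schwarz on their sum costs the factor [d], and each squared norm factorises. *)
Lemma rank1_sqr_dist u v (m : 'I_d -> R) : (forall j, 0 <= m j) ->
  (forall j, \sum_(i < n j) u j 0 i ^+ 2 <= m j ^+ 2) ->
  (forall j, \sum_(i < n j) v j 0 i ^+ 2 <= m j ^+ 2) ->
  \sum_(i : multi_index n) (\prod_j u j 0 (i j) - \prod_j v j 0 (i j)) ^+ 2 <=
  d%:R * \sum_j (\prod_(k | k != j) m k ^+ 2) * \sum_(i < n j) (u j 0 i - v j 0 i) ^+ 2.
Proof.
move=> m0 um vm.
pose w (j k : 'I_d) (x : 'I_(n k)) : R :=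
  if (k < j)%N then v k 0 x else if k == j then u k 0 x - v k 0 x else u k 0 x.
rewrite (@le_trans _ _ (\sum_(i : multi_index n) d%:R * \sum_j \prod_k w j k (i k) ^+ 2))//.
  apply: ler_sum => i _; rewrite (prod_sub_telescope (fun j => u j 0 (i j)) (fun j => v j 0 (i j))).
  rewrite (le_trans (sqr_sum_le _))// ler_wpM2l//.
  rewrite le_eqVlt; apply/orP; left; apply/eqP; apply: eq_bigr => j _.
  rewrite -prodrXl; apply: eq_bigr => k _; congr (_ ^+ 2); rewrite /w.
  by case: ifP => // _; case: eqP => // ->.
rewrite -mulr_sumr ler_wpM2l// exchange_big/=; apply: ler_sum => j _.
rewrite (sum_prod_dffun (fun k x => w j k x ^+ 2)) (bigD1 j)//= mulrC.
have -> : \sum_x w j j x ^+ 2 = \sum_(i < n j) (u j 0 i - v j 0 i) ^+ 2.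
  by apply: eq_bigr => x _; rewrite /w ltnn eqxx.
rewrite ler_wpM2r ?sumr_ge0// => [i _|]; first by rewrite sqr_ge0.
apply: ler_prod => k kj; rewrite sumr_ge0/= => [|x _]; last by rewrite sqr_ge0.
rewrite /w (negbTE kj); case: ltnP => _; [exact: vm|exact: um].
Qed.

(** Apply [powR_le_tangent] with exponent [2 / d] to the values [n_j * |u_i| ^+ d]; these have mean
    1, so the linear terms cancel in the sum over [i]. *)
Lemma lp_sphere_sqr_le u : (2 <= d)%N -> (forall j, (1 <= n j)%N) -> lp_sphere d u ->
  forall j, \sum_(i < n j) u j 0 i ^+ 2 <= ((n j)%:R `^ ((d%:R - 2) / (2 * d%:R))) ^+ 2.
Proof.
move=> d2 n1 u1 j.
have d0 : 0 < d%:R :> R by rewrite ltr0n ltnW.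
have d2' : 2 <= d%:R :> R by rewrite ler_nat.
have n0 : 0 < (n j)%:R :> R by rewrite ltr0n.
have a01 : 0 <= 2 / (d%:R : R) <= 1 by rewrite divr_ge0//= ler_pdivrMr// mul1r.
have nE : (n j)%:R `^ (2 / d%:R) * ((n j)%:R `^ ((d%:R - 2) / (2 * d%:R))) ^+ 2 = (n j)%:R :> R.
  rewrite -powR_mulrn ?powR_ge0// -powRrM -powRD; last by apply/implyP => _; rewrite gt_eqF.
  rewrite -[RHS]powRr1 ?ltW//; congr powR; field.
  by rewrite gt_eqF.
rewrite -(ler_pM2l (powR_gt0 (2 / d%:R) n0)) nE mulr_sumr.
rewrite (@le_trans _ _ (\sum_(i < n j) (1 + 2 / d%:R * ((n j)%:R * `|u j 0 i| ^+ d - 1))))//.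
  apply: ler_sum => i _.
  have -> : u j 0 i ^+ 2 = (`|u j 0 i| ^+ d) `^ (2 / d%:R).
    rewrite -[_ ^+ d]powR_mulrn// -powRrM (_ : d%:R * (2 / d%:R) = 2%:R).
      by rewrite powR_mulrn// real_normK ?num_real.
    by field; rewrite gt_eqF.
  rewrite -powRM ?exprn_ge0 ?(ltW n0)//; apply: powR_le_tangent => //.
rewrite big_split/= -mulr_sumr sumrB -mulr_sumr u1 !sumr_const card_ord.
by rewrite mulr1 subrr mulr0 addr0.
Qed.

End increments.

(** * The two singular values as instances of the general bound *)

Lemma singular_value_maxE (R : realType) (d : nat) (n : 'I_d -> nat) :
  (forall j, (0 < n j)%N) -> forall B : tensor R n,
  exists2 u, lp_sphere 2 u & tensor_inner B u = singular_value B /\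
    forall v, lp_sphere 2 v -> tensor_inner B v <= singular_value B.
Proof.
move=> n0 B; have [u u1 [uE umax]] := singular_value_max B n0.
exists u; first by move=> j; exact/euclidean_norm_eq1.
by split=> // v v1; rewrite -uE; apply: umax => j; exact/euclidean_norm_eq1.
Qed.

Lemma lp_singular_value_maxE (R : realType) (d : nat) (n : 'I_d -> nat) :
  (0 < d)%N -> (forall j, (0 < n j)%N) -> forall B : tensor R n,
  exists2 u, lp_sphere d u & tensor_inner B u = lp_singular_value B /\
    forall v, lp_sphere d v -> tensor_inner B v <= lp_singular_value B.
Proof.
move=> d0 n0 B; have [u u1 [uE umax]] := lp_singular_value_max B d0 n0.
exists u; first by move=> j; exact/lp_norm_eq1.
by split=> // v v1; rewrite -uE; apply: umax => j; exact/lp_norm_eq1.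
Qed.

Theorem theorem2p1 (R : realType) (disp : measure_display)
    (Omega : measurableType disp) (P : probability Omega R)
    (d : nat) (n : 'I_d -> nat) (A : multi_index n -> {RV P >-> R})
    (d_ge2 : (2 <= d)%N) (n_ge1 : forall j, (1 <= n j)%N)
    (A_indep : mutually_independent A)
    (A_normal : forall i, standard_normal (A i)) :
  ('E_P[fun w => singular_value (fun i => A i w)]
    <= (\sum_(j < d) Num.sqrt (n j)%:R)%:E)%E /\
  ('E_P[fun w => lp_singular_value (fun i => A i w)]
    <= (2 `^ (d%:R / 2)
        * ((pi : R) `^ (- (1 / 2)) * Gamma (1 / (2 * (d%:R - 1)) + 1))
            `^ ((d%:R - 1) / d%:R)
        * (\prod_(j < d) (n j)%:R `^ ((d%:R - 2) / (2 * d%:R)))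
        * (\sum_(j < d) (n j)%:R `^ (1 / 2)))%:E
    <= (2 `^ ((d%:R - 1) / 2)
        * (\prod_(j < d) (n j)%:R `^ ((d%:R - 2) / (2 * d%:R)))
        * (\sum_(j < d) (n j)%:R `^ (1 / 2)))%:E)%E.
Proof.
have d0 : (0 < d)%N by exact: ltnW.
pose j0 : 'I_d := Ordinal d0.
split.
  (* For [p = 2] the moment is the second one, at most 1, and the outer exponent is [1 / 2], which
     leaves [sqrt n_j]. *)
  have H := @gaussian_tensor_bound R disp Omega P d n A n_ge1 A_indep A_normal 2 j0
    (@singular_value R d n) (fun=> 1) isT (fun=> ler01)
    (singular_value_maxE n_ge1) (@rank1_sqr_dist_unit R d n).
  apply: (le_trans H); rewrite lee_fin; apply: ler_sum => j _; rewrite mul1r.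
  have -> : 1 / (2 * (2%:R - 1)) = 1 / 2 :> R by field.
  have -> : (2%:R - 1) / 2%:R = 2^-1 :> R by field.
  rewrite -powR12_sqrt//.
  have h12 : 0 <= (1 / 2 : R) <= 1 / 2 by rewrite lexx andbT divr_ge0.
  apply: ge0_ler_powR; rewrite ?nnegrE ?invr_ge0 ?mulr_ge0 ?(ltW (std_normal_abs_moment_gt0 h12))//.
  by rewrite ler_piMr// std_normal_abs_moment_le1.
pose s : R := 1 / (2 * (d%:R - 1)).
pose c : R := pi `^ (- (1 / 2)) * Gamma (s + 1).
pose m (j : 'I_d) : R := (n j)%:R `^ ((d%:R - 2) / (2 * d%:R)).
pose e : R := (d%:R - 1) / d%:R.
pose S : R := \sum_(j < d) (n j)%:R `^ (1 / 2).
have dR2 : 2 <= d%:R :> R by rewrite ler_nat.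
have dR0 : 0 < d%:R :> R by rewrite ltr0n.
have dR1 : 0 < d%:R - 1 :> R by lra.
have s01 : 0 < s <= 1 / 2.
  by rewrite /s divr_gt0 ?mulr_gt0//= ler_pdivrMr ?mulr_gt0//; lra.
have s01' : 0 <= s <= 1 / 2 by case/andP: s01 => /ltW -> ->.
have mom := std_normal_abs_moment s01; rewrite -/c in mom.
have mom1 := std_normal_abs_moment_le1 s01'.
have mom0 := std_normal_abs_moment_gt0 s01'.
have t0 : 0 < 2 `^ (s + 1 / 2) :> R by rewrite powR_gt0.
have c0 : 0 < c by rewrite -(pmulr_rgt0 _ t0) -mom.
have n0 j : 0 < (n j)%:R :> R by rewrite ltr0n.
have m0 j : 0 <= m j by exact: powR_ge0.
(* The exponent [e] turns the power of 2 in the moment into [sqrt 2], whatever [d]. *)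
have se : (s + 1 / 2) * e = 1 / 2 by rewrite /s /e; field; rewrite !gt_eqF.
have mome : (\int[@normal_prob R 0 1]_x (`|x| `^ (2 * s + 1))) `^ e = 2 `^ (1 / 2) * c `^ e.
  by rewrite mom powRM ?ltW// -powRrM se.
have S0 : 0 <= S by apply: sumr_ge0 => j _; exact: powR_ge0.
have Pm0 : 0 <= \prod_j m j by apply: prodr_ge0.
apply/andP; split; last first.
  (* The moment is at most 1, so [sqrt 2 * c ^ e <= 1]; this removes one factor [sqrt 2] from
     [2 ^ (d / 2)]. *)
  rewrite lee_fin -/s -/c -/e -/S ler_wpM2r// ler_wpM2r//.
  have -> : d%:R / 2 = (d%:R - 1) / 2 + 1 / 2 :> R by field.
  rewrite powRD; last by apply/implyP => _; rewrite pnatr_eq0.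
  rewrite -mulrA ler_piMr ?powR_ge0// -mome.
  have e0 : 0 <= e by rewrite divr_ge0// ltW.
  rewrite [leRHS](_ : 1 = 1 `^ e); last by rewrite powR1.
  apply: (ge0_ler_powR e0) => //; first by rewrite nnegrE (ltW mom0).
  by rewrite nnegrE.
pose lam (j : 'I_d) := Num.sqrt d%:R * \prod_(k | k != j) m k.
have lam0 j : 0 <= lam j by rewrite mulr_ge0 ?sqrtr_ge0// prodr_ge0.
have inc (u v : vectors R n) : lp_sphere d u -> lp_sphere d v ->
  \sum_(i : multi_index n) (\prod_j u j 0 (i j) - \prod_j v j 0 (i j)) ^+ 2 <=
  \sum_j \sum_(i < n j) (lam j * u j 0 i - lam j * v j 0 i) ^+ 2.
  move=> u1 v1; rewrite (le_trans (rank1_sqr_dist m0 _ _))//.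
  - exact: lp_sphere_sqr_le.
  - exact: lp_sphere_sqr_le.
  rewrite mulr_sumr le_eqVlt; apply/orP; left; apply/eqP; apply: eq_bigr => j _.
  rewrite mulrA mulr_sumr; apply: eq_bigr => i _.
  by rewrite -mulrBr exprMn /lam exprMn sqr_sqrtr ?ltW// prodrXl.
have H := @gaussian_tensor_bound R disp Omega P d n A n_ge1 A_indep A_normal d j0
    (@lp_singular_value R d n) lam d_ge2 lam0 (lp_singular_value_maxE d0 n_ge1) inc.
apply: (le_trans H); rewrite lee_fin -/s -/e -/c -/S.
(* Writing [n_j ^ e] as [n_j ^ (1 / 2) * m j] supplies the factor missing from [lam j], so the full
   product comes out of the sum. *)
have term j : lam j * ((n j)%:R * \int[@normal_prob R 0 1]_x (`|x| `^ (2 * s + 1))) `^ e =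
    Num.sqrt d%:R * 2 `^ (1 / 2) * c `^ e * (\prod_k m k) * (n j)%:R `^ (1 / 2).
  rewrite powRM ?ltW// mome /lam [in RHS](bigD1 j)//=.
  have -> : (n j)%:R `^ e = (n j)%:R `^ (1 / 2) * m j.
    rewrite /m -powRD; last by apply/implyP => _; rewrite gt_eqF.
    by congr powR; rewrite /e; field; rewrite gt_eqF.
  ring.
rewrite (eq_bigr _ (fun j _ => term j)) -mulr_sumr -/S.
rewrite ler_wpM2r// ler_wpM2r// ler_wpM2r ?powR_ge0//.
have -> : d%:R / 2 = (d%:R - 1) / 2 + 1 / 2 :> R by field.
rewrite powRD; last by apply/implyP => _; rewrite pnatr_eq0.
rewrite ler_wpM2r ?powR_ge0//.
(* [sqrt d <= 2 ^ ((d - 1) / 2)] reduces to [d <= 2 ^ (d - 1)]. *)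
rewrite -powR12_sqrt// powRrM.
apply: ge0_ler_powR; rewrite ?nnegrE ?invr_ge0 ?powR_ge0//.
have -> : d%:R - 1 = d.-1%:R :> R by rewrite -subn1 natrB.
by rewrite powR_mulrn// -natrX ler_nat -{1}(prednK d0) ltn_expl.
Qed.
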